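(* Let $(Y,\mathcal{D},\nu,G)$ be a measurable dynamical $G$-system, $\mathcal{C}\subseteq\mathcal{D}$ a $G$-invariant sub-$\sigma$-algebra and $\alpha,\beta\in\mathbf{P}_Y$. Then, for $\beta_G$ the sub-$\sigma$-algebra of $\mathcal{D}$ generated by $g^{-1}\beta$, $g\in G$, $$\lim_{n\to\infty}\frac{1}{|F_n|}H_\nu(\alpha_{F_n}|\beta_{F_n}\vee\mathcal{C})=h_\nu(G,\alpha|\beta_G\vee\mathcal{C})$$ and so $$h_\nu(G,\alpha\vee\beta|\mathcal{C})=h_\nu(G,\beta|\mathcal{C})+h_\nu(G,\alpha|\beta_G\vee\mathcal{C}).$$
   Context: $G$ is an infinite countable discrete amenable group with identity $e_G$, and $\{F_n\}_{n\in\mathbb{N}}$ is a fixed F\o lner sequence of non-empty finite subsets of $G$ ($|gF_n\Delta F_n|/|F_n|\to0$ for every $g\in G$) with $e_G\in F_1\subsetneq F_2\subsetneq\cdots$. A measurable dynamical $G$-system $(Y,\mathcal{D},\nu,G)$ is a probability space $(Y,\mathcal{D},\nu)$ together with an action of $G$ by invertible measure-preserving transformations, $e_G$ acting as the identity. $\mathcal{C}$ is $G$-invariant if $g^{-1}\mathcal{C}=\mathcal{C}$ up to $\nu$-null sets for each $g\in G$. $\mathbf{P}_Y$ is the set of finite measurable partitions of $Y$; $\alpha_F=\bigvee_{g\in F}g^{-1}\alpha$ for finite non-empty $F\subseteq G$. A partition is identified with the $\sigma$-algebra it generates, and $\mathcal{C}_1\vee\mathcal{C}_2$ is the $\sigma$-algebra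 generated by $\mathcal{C}_1$ and $\mathcal{C}_2$. $H_\nu(\alpha|\mathcal{C})=-\sum_{A\in\alpha}\int_Y\nu(A|\mathcal{C})\log\nu(A|\mathcal{C})\,d\nu$, with $\nu(A|\mathcal{C})$ the conditional expectation of $1_A$. For $G$-invariant $\mathcal{C}$, $h_\nu(G,\alpha|\mathcal{C})=\lim_n\frac{1}{|F_n|}H_\nu(\alpha_{F_n}|\mathcal{C})$ (the limit exists). *)

(* Defs.v *)
From HB Require Import structures.
From mathcomp Require Import all_boot all_order all_algebra.
From mathcomp Require Import finmap.
From mathcomp Require Import all_classical all_reals all_analysis.
(* Not exported by all_analysis; needed for measurability into \bar R. *)
From mathcomp Require Import measurable_realfun.

Set Implicit Arguments.
Unset Strict Implicit.
Unset Printing Implicit Defensive.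

Import Order.TTheory GRing.Theory Num.Theory.
Import numFieldNormedType.Exports.

Local Open Scope classical_set_scope.
Local Open Scope ring_scope.

(* The sequence is indexed from 0: [F n] is the (n+1)-st Folner set.
   Amenability of the countable group [G] is the existence of such an [F]. *)
Record folner (R : realType) (G : groupType) (F : nat -> {fset G}) : Prop := {
  folner_neq0 : forall n, F n != fset0 ;
  folner_id : (1%g : G) \in F 0%N ;
  folner_proper : forall n, (F n `<` F n.+1)%fset ;
  folner_cvg : forall g : G,
    let gF n := [fset (g * x)%g | x in F n]%fset in
    (#|` ((gF n `\` F n) `|` (F n `\` gF n))%fset|%:R / #|` F n|%:R : R)
      @[n --> \oo] --> (0 : R) }.

(* A left action; each [act g] is invertible with inverse [act g^-1]. *)
Record mp_action (R : realType) (d : measure_display) (Y : measurableType d)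
    (nu : probability Y R) (G : groupType) (act : G -> Y -> Y) : Prop := {
  mp_action1 : forall y, act 1%g y = y ;
  mp_actionM : forall g h y, act (g * h)%g y = act g (act h y) ;
  mp_action_measurable : forall g, measurable_fun [set: Y] (act g) ;
  mp_action_preserving : forall g A, measurable A ->
    nu (act g @^-1` A) = nu A }.

Section SigmaAlgebras.
Context (R : realType) (d : measure_display) (Y : measurableType d).
Implicit Types C D : set (set Y).

Definition is_sub_sigma C : Prop :=
  sigma_algebra [set: Y] C /\ C `<=` measurable.

Definition sigma_join C D : set (set Y) := <<s C `|` D >>.

Definition null_eq (nu : probability Y R) (A B : set Y) : Prop :=
  nu ((A `\` B) `|` (B `\` A)) = 0%E.

Definition invariant_sigma (nu : probability Y R) (G : groupType)
    (act : G -> Y -> Y) C : Prop :=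
  forall g : G,
    (forall A, C A -> exists2 B, C B & null_eq nu (act g @^-1` A) B) /\
    (forall B, C B -> exists2 A, C A & null_eq nu (act g @^-1` A) B).

End SigmaAlgebras.

Section Partitions.
Context (d : measure_display) (Y : measurableType d).
Implicit Types P Q : {fset (set Y)}.

(* The empty cell is allowed: joins below may create it. *)
Record measurable_partition P : Prop := {
  mpart_measurable : forall A, A \in P -> measurable A ;
  mpart_disjoint : forall A B, A \in P -> B \in P -> A != B ->
    A `&` B = set0 ;
  mpart_cover : \bigcup_(A in [set` P]) A = [set: Y] }.

Definition part_join P Q : {fset (set Y)} :=
  [fset (A `&` B)%classic | A in P, B in Q]%fset.

Definition part_preim (f : Y -> Y) P : {fset (set Y)} :=
  [fset (f @^-1` A)%classic | A in P]%fset.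

Definition part_sigma P : set (set Y) := <<s [set` P] >>.

Definition part_orbit (G : groupType) (act : G -> Y -> Y) P (F : {fset G}) :
    {fset (set Y)} :=
  \big[part_join/[fset [set: Y]]%fset]_(g <- F) part_preim (act g) P.

Definition orbit_sigma (G : groupType) (act : G -> Y -> Y) P : set (set Y) :=
  <<s \bigcup_(g in [set: G]) [set` part_preim (act g) P] >>.

End Partitions.

Section Entropy.
Context (R : realType) (d : measure_display) (Y : measurableType d).
Context (nu : probability Y R).
Implicit Types (C : set (set Y)) (P : {fset (set Y)}).

Definition is_cond_exp C (X f : Y -> R) : Prop :=
  [/\ forall B : set R, measurable B -> C (f @^-1` B),
      nu.-integrable [set: Y] (EFin \o f) &
      forall A, C A ->
        (\int[nu]_(y in A) (f y)%:E = \int[nu]_(y in A) (X y)%:E)%E].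

(* A version chosen among those of the conditional expectation, which
   are all equal almost everywhere; one exists by [cond_expP] below. *)
Definition cond_exp C (X : Y -> R) : Y -> R :=
  xget (cst 0) [set f | is_cond_exp C X f].

Definition cond_prob C (A : set Y) : Y -> R := cond_exp C \1_A.

(* [ln 0 = 0] in the library, so that 0 log 0 = 0. *)
Definition cond_entropy P C : R :=
  - \sum_(A <- P) \int[nu]_y (cond_prob C A y * ln (cond_prob C A y)).

Definition mean_entropy (G : groupType) (F : nat -> {fset G})
    (act : G -> Y -> Y) P C : R :=
  lim ((cond_entropy (part_orbit act P (F n)) C / #|` F n|%:R)
         @[n --> \oo]).

End Entropy.

Lemma cond_exp_factor (R : realType) (d d' : measure_display)
    (Y : measurableType d) (T : measurableType d') (nu : probability Y R)
    (phi : Y -> T) (X : Y -> R) :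
  measurable_fun [set: Y] phi -> nu.-integrable [set: Y] (EFin \o X) ->
  exists f : T -> R, [/\ measurable_fun [set: T] f,
    nu.-integrable [set: Y] (EFin \o (f \o phi)) &
    forall A, measurable A -> (\int[nu]_(y in phi @^-1` A) (f (phi y))%:E =
       \int[nu]_(y in phi @^-1` A) (X y)%:E)%E].
Proof.
move=> mphi iX.
have mpre A : measurable A -> measurable (phi @^-1` A).
  by move=> mA; rewrite -[_ @^-1` _]setTI; exact: mphi.
pose mu0 : {measure set T -> \bar R} := pushforward nu phi.
pose mu := mu0 mphi.
have muT : mu setT = 1%E.
  by rewrite /mu /= /pushforward preimage_setT probability_setT.
pose Pm := Measure_isProbability.Build _ _ _ mu muT.
pose P : probability T R := HB.pack (Measure.sort mu) Pm.
pose X' : {charge set Y -> \bar R} := induced_charge iX.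
pose chi0 : {charge set T -> \bar R} := pushforward X' phi.
pose chi := chi0 mphi.
have dom : chi `<< P.
  apply/null_content_dominatesP => A mA PA.
  apply: (@null_set_integral _ _ _ nu (phi @^-1` A) (EFin \o X) (mpre _ mA) _ PA).
  apply: (measurable_funS measurableT (@subsetT _ _)); exact: measurable_int iX.
have Hint : P.-integrable setT (Radon_Nikodym chi P) := Radon_Nikodym_integrable dom.
pose g := Radon_Nikodym chi P.
have mg : measurable_fun setT g := measurable_int P Hint.
have gfin x : g x \is a fin_num by exact: Radon_Nikodym_fin_num.
have inu : nu.-integrable [set: Y] (g \o phi).
  apply/integrableP; split; first exact: measurableT_comp.
  have /integrableP [_] := Hint.
  rewrite [X in (X < _)%E](@ge0_integral_pushforward _ _ Y T _ phi mphi nu setT (abse \o g)) //.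
  by apply: measurableT_comp.
  by move=> y _; exact: abse_ge0.
exists (fun x => fine (g x)); split.
- by apply: measurableT_comp => //.
- by apply: eq_integrable inu => //= y _ /=; rewrite fineK.
- move=> A mA.
  have := @Radon_Nikodym_integral _ _ _ chi P A dom mA.
  rewrite [LHS]/= /pushforward /X' /= /induced_charge => ->.
  rewrite [RHS](@integral_pushforward _ _ Y T _ phi mphi nu A g mg) //.
    by apply: eq_integral => y _; rewrite /= fineK.
  by apply: integrableS inu => //; exact: mpre.
Qed.

Lemma cond_expP (R : realType) (d : measure_display) (Y : measurableType d)
  (nu : probability Y R) (C : set (set Y)) (X : Y -> R) :
  is_sub_sigma C -> nu.-integrable [set: Y] (EFin \o X) ->
  is_cond_exp nu C X (cond_exp nu C X).
Proof.
move=> [sC Cm] iX; apply: (@xgetPex _ (cst 0) [set f | is_cond_exp nu C X f]).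
have mC := measurable_g_measurableTypeE sC.
have [|f [mf fint fE]] := @cond_exp_factor R _ _ Y (g_sigma_algebraType C) nu idfun X _ iX.
  by move=> _ A mA; rewrite setTI; apply: Cm; rewrite -mC.
exists f; split => //.
- by move=> B mB; rewrite -mC -[_ @^-1` _]setTI; exact: mf.
- by move=> A CA; apply: fE; rewrite mC.
Qed.

(* Main.v *)
Require Import Defs.
From HB Require Import structures.
From mathcomp Require Import all_boot all_order all_algebra.
From mathcomp Require Import finmap.
From mathcomp Require Import all_classical all_reals all_analysis.
From mathcomp Require Import measurable_realfun ring lra.

Set Implicit Arguments.
Unset Strict Implicit.
Unset Printing Implicit Defensive.

Import Order.TTheory GRing.Theory Num.Theory.
Import numFieldNormedType.Exports.

Local Open Scope classical_set_scope.
Local Open Scope ring_scope.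

(** For a finite subset [S] of the group write H(S | D) for the entropy of the
    join of the translates of [alpha] over [S], given a sub-sigma-algebra [D];
    denote the join of the translates of [beta] over [S] by beta_S.

    Set a_n = H(F_n | beta_{F_n} v C) / |F_n| and
    b_n = H(F_n | beta_G v C) / |F_n|.  Conditioning on more decreases entropy, so
    b_n <= a_n.  Conversely, for every m and every e > 0 one has a_n <= b_m + e for
    large n ([mean_entropy_eventually]).  Hence both sequences converge to the
    infimum of b.  This gives the first claim together with the existence of the
    limit that defines the mean entropy given beta_G v C.  The same result for the
    trivial partition in place of [beta] gives the existence of the mean entropy
    given [C], and the second claim is then the limit of the chain rule
    H(alpha_F v beta_F | C) = H(beta_F | C) + H(alpha_F | beta_F v C).

    For the upper bound on a_n, let K = F_m and choose a finite [L] containing the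
    identity with H(K | beta_L v C) close to H(K | beta_G v C).  The right translates
    Kc cover every point of F_n exactly |K| times, and S |-> H(S | D) is monotone
    and strongly subadditive, so a Shearer inequality bounds |K| H(F_n | D) by the
    sum of the H(Kc | D), where D = beta_{F_n} v C ([entropy_count]).  If Lc lies in
    F_n, the term is at most H(Kc | beta_{Lc} v C) = H(K | beta_L v C) by invariance.
    There are at most |F_n| such [c]; the number of the others that count is
    negligible by the Folner property, and their terms are at most H(K | C).

    The properties of conditional entropy rest on a variational formula: the
    contribution of a cell [A] given [D] is the infimum, over [D]-measurable
    positive q, of the integral of q - 1_A - 1_A log q ([gibbs]).  A predictor q may
    be perturbed in L1 at small cost, so a sigma-algebra that approximates finitely
    many level sets of an almost optimal q gives almost the same value
    ([cell_entropy_approx]).  Monotonicity in the conditioning, the convergence of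
    H(K | beta_L v C) to H(K | beta_G v C) without martingale theory, and the
    invariance under the action when [C] is invariant only up to null sets all
    follow. *)

(** * Bounded functions measurable for a sub-sigma-algebra *)

Section BoundedMeasurable.
Context {R : realType} {d : measure_display} {Y : measurableType d}.
Implicit Types (D : set (set Y)) (f g : Y -> R).

(** [f] is bounded and [D]-measurable.  Measurability is that of the library on
    the measurable type generated by [D], so that its closure lemmas apply; when
    [D] is a sigma-algebra, it says that preimages of Borel sets are in [D]. *)
Definition bounded_meas D f : Prop :=
  measurable_fun [set: g_sigma_algebraType D] (f : g_sigma_algebraType D -> R)
  /\ exists M, forall y, `|f y| <= M.

Lemma bounded_meas_cst D (r : R) : bounded_meas D (fun=> r).
Proof. by split; [exact: measurable_cst | exists `|r|]. Qed.

Lemma bounded_measD D f g : bounded_meas D f -> bounded_meas D g ->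
  bounded_meas D (fun y => f y + g y).
Proof.
move=> [mf [M fM]] [mg [N gN]]; split; first exact: measurable_funD.
by exists (M + N) => y; rewrite (le_trans (ler_normD _ _))// lerD.
Qed.

Lemma bounded_measM D f g : bounded_meas D f -> bounded_meas D g ->
  bounded_meas D (fun y => f y * g y).
Proof.
move=> [mf [M fM]] [mg [N gN]]; split; first exact: measurable_funM.
by exists (M * N) => y; rewrite normrM ler_pM.
Qed.

Lemma bounded_measN D f : bounded_meas D f -> bounded_meas D (fun y => - f y).
Proof.
move=> [mf [M fM]]; split; first exact: measurable_funN.
by exists M => y; rewrite normrN.
Qed.

Lemma bounded_measB D f g : bounded_meas D f -> bounded_meas D g ->
  bounded_meas D (fun y => f y - g y).
Proof. by move=> bf bg; apply: bounded_measD => //; exact: bounded_measN. Qed.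

Lemma bounded_meas_norm D f : bounded_meas D f ->
  bounded_meas D (fun y => `|f y|).
Proof.
move=> [mf [M fM]]; split; first exact: measurableT_comp.
by exists M => y; rewrite normr_id.
Qed.

Lemma bounded_meas_sum D (I : eqType) (s : seq I) (f : I -> Y -> R) :
  (forall i, i \in s -> bounded_meas D (f i)) ->
  bounded_meas D (fun y => \sum_(i <- s) f i y).
Proof.
elim: s => [_|i s ih bf].
  have -> : (fun y => \sum_(i <- [::]) f i y) = fun=> 0.
    by apply/funext => y; rewrite big_nil.
  exact: bounded_meas_cst.
have -> : (fun y => \sum_(i <- i :: s) f i y) =
    fun y => f i y + \sum_(i <- s) f i y.
  by apply/funext => y; rewrite big_cons.
apply: bounded_measD; first by apply: bf; rewrite mem_head.
by apply: ih => j js; apply: bf; rewrite inE js orbT.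
Qed.

Lemma bounded_meas_indic D (A : set Y) : D A -> bounded_meas D \1_A.
Proof.
move=> DA; split.
  by apply: (@measurable_indic _ (g_sigma_algebraType D)); exact: sub_sigma_algebra.
by exists 1 => y; rewrite indicE; case: (_ \in _); rewrite ?normr1 ?normr0.
Qed.

Lemma bounded_meas_comp D (F : R -> R) f (M : R) :
  measurable_fun setT F -> bounded_meas D f ->
  (forall y, `|F (f y)| <= M) -> bounded_meas D (fun y => F (f y)).
Proof. by move=> mF [mf _] FM; split; [exact: measurableT_comp | exists M]. Qed.

Lemma bounded_meas_sub D D' f : D `<=` D' -> bounded_meas D f -> bounded_meas D' f.
Proof.
move=> DD [mf bf]; split => // _ B mB; rewrite setTI.
by apply: (sub_sigma_algebra2 DD); rewrite -[X in <<s _ >> X]setTI; apply: mf.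
Qed.

Lemma bounded_meas_preimage D f (B : set R) : sigma_algebra setT D ->
  bounded_meas D f -> measurable B -> D (f @^-1` B).
Proof.
move=> sD [mf _] mB; rewrite -(measurable_g_measurableTypeE sD).
by rewrite -[_ @^-1` _]setTI; exact: mf.
Qed.

Lemma bounded_meas_level D f (t : R) : sigma_algebra setT D ->
  bounded_meas D f -> D [set y | t <= f y].
Proof.
move=> sD bf; have -> : [set y | t <= f y] = f @^-1` `[t, +oo[.
  by apply/seteqP; split => y /=; rewrite in_itv/= andbT.
exact: bounded_meas_preimage.
Qed.

End BoundedMeasurable.

Section Expectation.
Context {R : realType} {d : measure_display} {Y : measurableType d}.
Context (nu : probability Y R).
Implicit Types (D : set (set Y)) (f g : Y -> R).

Local Notation bm := (@bounded_meas R d Y (@measurable d Y)).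
Local Notation E f := (Rintegral nu setT f).

Lemma bounded_meas_measurable f : bm f -> measurable_fun setT f.
Proof.
move=> bf _ B mB; rewrite setTI.
by apply: bounded_meas_preimage mB => //; exact: sigma_algebra_measurable.
Qed.

Lemma bounded_meas_integrable f : bm f -> nu.-integrable setT (EFin \o f).
Proof.
move=> bf; apply: measurable_bounded_integrable => //.
- by apply: (@le_lt_trans _ _ 1%E); [exact: probability_le1 | exact: ltry].
- exact: bounded_meas_measurable.
- case: bf => _ [M fM]; exists M; split; first exact: num_real.
  by move=> x Mx y _; exact: (le_trans (fM y) (ltW Mx)).
Qed.

Lemma expectD f g : bm f -> bm g -> E (fun y => f y + g y) = E f + E g.
Proof. by move=> bf bg; rewrite RintegralD//; exact: bounded_meas_integrable. Qed.

Lemma expectB f g : bm f -> bm g -> E (fun y => f y - g y) = E f - E g.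
Proof. by move=> bf bg; rewrite RintegralB//; exact: bounded_meas_integrable. Qed.

Lemma expectZ r f : bm f -> E (fun y => r * f y) = r * E f.
Proof. by move=> bf; rewrite RintegralZl//; exact: bounded_meas_integrable. Qed.

Lemma expectN f : bm f -> E (fun y => - f y) = - E f.
Proof.
move=> bf; rewrite -mulN1r -expectZ//.
by congr Rintegral; apply/funext => y; rewrite mulN1r.
Qed.

Lemma expect_le f g : bm f -> bm g -> (forall y, f y <= g y) -> E f <= E g.
Proof. by move=> bf bg fg; apply: le_Rintegral => //; exact: bounded_meas_integrable. Qed.

Lemma expect_cst (r : R) : E (fun=> r) = r.
Proof.
rewrite Rintegral_cst// -[RHS]mulr1; congr (_ * _).
exact: (f_equal fine (probability_setT nu)).
Qed.

Lemma expect_sum (I : eqType) (s : seq I) (f : I -> Y -> R) :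
  (forall i, i \in s -> bm (f i)) ->
  E (fun y => \sum_(i <- s) f i y) = \sum_(i <- s) E (f i).
Proof.
elim: s => [_|i s ih bf].
  rewrite big_nil -[RHS](expect_cst 0); congr Rintegral.
  by apply/funext => y; rewrite big_nil.
have bs j : j \in s -> bm (f j) by move=> js; apply: bf; rewrite inE js orbT.
have bi : bm (f i) by apply: bf; rewrite mem_head.
rewrite big_cons -ih// -expectD//; last exact: bounded_meas_sum.
by congr Rintegral; apply/funext => y; rewrite big_cons.
Qed.

Lemma expect_indic A : measurable A -> E \1_A = fine (nu A).
Proof. by move=> mA; rewrite /Rintegral integral_indic// setIT. Qed.

Lemma expect_norm f : bm f -> `|E f| <= E (fun y => `|f y|).
Proof. by move=> bf; apply: le_normr_Rintegral => //; exact: bounded_meas_integrable. Qed.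

Lemma expect_dist f g (e : R) : bm f -> bm g -> (forall y, `|f y - g y| <= e) ->
  `|E f - E g| <= e.
Proof.
move=> bf bg fg; rewrite -expectB//.
have bfg := bounded_measB bf bg.
rewrite (le_trans (expect_norm bfg))// -[leRHS](expect_cst e).
by apply: expect_le => //; [exact: bounded_meas_norm|exact: bounded_meas_cst].
Qed.

(** Two bounded functions at zero distance in L2 agree almost everywhere. *)
Lemma expect_sqr_eq0 f g : bm f -> bm g ->
  E (fun y => (f y - g y) * (f y - g y)) = 0 -> ae_eq nu setT f g.
Proof.
move=> bf bg E0; have bh := bounded_measB bf bg.
pose h y := (f y - g y) * (f y - g y).
have bhh : bm h by exact: bounded_measM.
have mh : measurable_fun setT (EFin \o h).
  by apply/measurable_EFinP; exact: bounded_meas_measurable.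
have : (\int[nu]_y `|(EFin \o h) y|)%E = 0%E.
  under eq_integral => y _.
    rewrite /= ger0_norm; first over.
    by rewrite /h -expr2 sqr_ge0.
  have /= := integrable_fin_num measurableT (bounded_meas_integrable bhh).
  by move/fineK => <-; rewrite [fine _]E0.
move/(ae_eq_integral_abs nu measurableT mh).
apply: filterS => y /= /(_ I) [] /eqP.
by rewrite mulf_eq0 orbb subr_eq0 => /eqP ->.
Qed.

Lemma expect_ae f g : bm f -> bm g -> ae_eq nu setT f g -> E f = E g.
Proof.
move=> bf bg fg; rewrite /Rintegral; congr fine.
apply: ae_eq_integral => //.
- by apply/measurable_EFinP; exact: bounded_meas_measurable.
- by apply/measurable_EFinP; exact: bounded_meas_measurable.
- by apply: filterS fg => y /= h /h ->.
Qed.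

End Expectation.

(** * Uniform approximation by level sets *)

Section Staircase.
Context {R : realType} {T : Type}.
Implicit Types f : T -> R.

(** The [j]-th of the [m] superlevel sets that cut [0, 1] in equal steps; the
    thresholds are 1/m, ..., 1, hence the successor. *)
Definition level f (m j : nat) : set T := [set y | j.+1%:R / m%:R <= f y].

(** For [x] in [0, m] the sum is the integer part of [x]. *)
Lemma sum_le_bounds (m : nat) (x : R) : 0 <= x <= m%:R ->
  x - 1 <= \sum_(j < m) (j.+1%:R <= x)%R%:R <= x.
Proof.
elim: m => [|m ih] /andP[x0 xm].
  by rewrite big_ord0 subr_le0 x0 andbT (le_trans xm).
rewrite big_ord_recr/=; have [xlem|mltx] := leP x m%:R.
  rewrite (leNgt m.+1%:R) (le_lt_trans xlem) ?ltr_nat//= addr0.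
  by apply: ih; rewrite x0.
have -> : \sum_(i < m) (i.+1%:R <= x)%R%:R = m%:R :> R.
  rewrite (eq_bigr (fun=> 1)) => [|i _]; first by rewrite sumr_const card_ord.
  by rewrite (le_trans _ (ltW mltx))// ler_nat.
rewrite -natr1 in xm *; have [h|h] := leP (m%:R + 1) x => /=; lra.
Qed.

Lemma staircase_dist f (m : nat) y : (0 < m)%N -> 0 <= f y <= 1 ->
  `|f y - \sum_(j < m) m%:R^-1 * \1_(level f m j) y| <= m%:R^-1.
Proof.
move=> m0 /andP[f0 f1]; have m0' : 0 < m%:R :> R by rewrite ltr0n.
rewrite -mulr_sumr.
have -> : f y = m%:R^-1 * (m%:R * f y) by rewrite mulrA mulVf ?mul1r// gt_eqF.
rewrite -mulrBr normrM ger0_norm ?invr_ge0 ?ler0n// ler_piMr ?invr_ge0 ?ler0n//.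
have -> : \sum_(j < m) \1_(level f m j) y = \sum_(j < m) (j.+1%:R <= m%:R * f y)%R%:R :> R.
  apply: eq_bigr => j _; rewrite indicE; congr (nat_of_bool _)%:R.
  have ->: (y \in level f m j) = (j.+1%:R / m%:R <= f y).
    by apply/idP/idP => [/set_mem//|h]; apply/mem_set.
  by rewrite ler_pdivrMr// mulrC.
have /andP[h1 h2] : m%:R * f y - 1 <= \sum_(j < m) (j.+1%:R <= m%:R * f y)%R%:R <= m%:R * f y.
  by apply: sum_le_bounds; rewrite mulr_ge0 ?ler0n//= ler_piMr ?ler0n.
by rewrite ger0_norm ?subr_ge0// lerBlDr -lerBlDl.
Qed.

End Staircase.

(** * Conditional probabilities as bounded functions *)

Section Versions.
Context {R : realType} {d : measure_display} {Y : measurableType d}.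
Context (nu : probability Y R).
Implicit Types (D : set (set Y)) (A S : set Y) (f g u : Y -> R).

Local Notation bm := (@bounded_meas R d Y (@measurable d Y)).
Local Notation E f := (Rintegral nu setT f).

(** [f] is a version of the conditional probability of [A] given [D] that takes
    its values in [0, 1] everywhere, and not only almost everywhere. *)
Definition is_version D A f : Prop :=
  [/\ bounded_meas D f, forall y, 0 <= f y <= 1 &
      forall S, D S -> E (fun y => f y * \1_S y) = E (fun y => \1_A y * \1_S y)].

(** The defining identity, known for indicators of sets of [D], passes to [u]
    by uniform approximation with the staircase of the level sets of [u]. *)
Lemma version_pullout01 D A f u : is_sub_sigma D -> measurable A ->
  is_version D A f -> bounded_meas D u -> (forall y, 0 <= u y <= 1) ->
  E (fun y => f y * u y) = E (fun y => \1_A y * u y).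
Proof.
move=> [sD Dm] mA [bf f01 fE] bu u01.
have bf' := bounded_meas_sub Dm bf; have bu' := bounded_meas_sub Dm bu.
have bA : bm \1_A by exact: bounded_meas_indic.
have DL m j : D (level u m j) by exact: bounded_meas_level.
have bL m j : bm \1_(level u m j) by apply: bounded_meas_indic; exact/Dm.
pose s m (y : Y) : R := \sum_(j < m) m%:R^-1 * \1_(level u m j) y.
have bs m : bm (s m).
  apply: bounded_meas_sum => j _; apply: bounded_measM => //; exact: bounded_meas_cst.
have approx g m : bm g -> (forall y, 0 <= g y <= 1) -> (0 < m)%N ->
    `|E (fun y => g y * u y) - E (fun y => g y * s m y)| <= m%:R^-1.
  move=> bg g01 m0; apply: expect_dist; [exact: bounded_measM|exact: bounded_measM|].
  move=> y; rewrite -mulrBr normrM; have /andP[g0 g1] := g01 y.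
  rewrite (ger0_norm g0) -[leRHS]mul1r ler_pM//.
  exact: staircase_dist.
have sE m : E (fun y => f y * s m y) = E (fun y => \1_A y * s m y).
  have h g : bm g -> E (fun y => g y * s m y) =
      \sum_(j < m) m%:R^-1 * E (fun y => g y * \1_(level u m j) y).
    move=> bg.
    transitivity (\sum_(j < m) E (fun y => m%:R^-1 * (g y * \1_(level u m j) y))).
      rewrite -expect_sum; last first.
        by move=> j _; apply: bounded_measM; [exact: bounded_meas_cst|exact: bounded_measM].
      congr Rintegral; apply/funext => y; rewrite mulr_sumr; apply: eq_bigr => j _.
      by rewrite mulrCA.
    by apply: eq_bigr => j _; rewrite expectZ//; exact: bounded_measM.
  by rewrite h// h//; apply: eq_bigr => j _; rewrite fE.
have A01 y : 0 <= (\1_A y : R) <= 1 by rewrite indicE; case: (_ \in _); rewrite /= ?lexx ?ler01.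
(* Both sides are within 1/m of their staircase approximations. *)
apply/eqP; rewrite -subr_eq0 -normr_le0; apply/ler_addgt0Pl => e e0; rewrite addr0.
have [m m0 me] : exists2 m, (0 < m)%N & m%:R^-1 <= e / 2.
  exists (Num.truncn (e / 2)^-1).+1 => //.
  have e20 : 0 < e / 2 by rewrite divr_gt0.
  by rewrite -[leRHS]invrK lef_pV2 ?posrE ?invr_gt0// ltW// truncnS_gt.
have h1 := approx f m bf' f01 m0; have h2 := approx _ m bA A01 m0.
rewrite sE in h1; move: h1 h2; rewrite distrC => h1 h2.
rewrite distrC; apply: le_trans (ler_distD (E (fun y => \1_A y * s m y)) _ _) _.
by rewrite [leRHS]splitr lerD// ?(le_trans h1)// ?(le_trans h2).
Qed.

Lemma version_pullout D A f u : is_sub_sigma D -> measurable A ->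
  is_version D A f -> bounded_meas D u ->
  E (fun y => f y * u y) = E (fun y => \1_A y * u y).
Proof.
move=> sD mA vf bu; have [_ [M uM]] := bu; have [bf f01 _] := vf.
(* An affine change of variable brings [u] into [0, 1]. *)
pose K := `|M| + 1; have K0 : 0 < K by rewrite /K ltr_wpDl.
have uK y : `|u y| <= K.
  by rewrite (le_trans (uM y))// /K (le_trans (ler_norm _))// lerDl.
pose v y := (u y + K) * (2 * K)^-1.
have bv : bounded_meas D v.
  by apply: bounded_measM; [apply: bounded_measD => //|]; exact: bounded_meas_cst.
have v01 y : 0 <= v y <= 1.
  have := uK y; rewrite ler_norml => /andP[u1 u2].
  rewrite /v ler_pdivrMr ?mulr_gt0//; apply/andP; split; last by lra.
  by rewrite divr_ge0 ?mulr_ge0 ?(ltW K0)//; lra.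
have h1 := version_pullout01 sD mA vf bv v01.
have b1 : bounded_meas D (fun=> 1 : R) by exact: bounded_meas_cst.
have h2 := version_pullout01 sD mA vf b1 (fun=> introT andP (conj ler01 (lexx 1))).
have [_ Dm] := sD.
have bA : bm \1_A by exact: bounded_meas_indic.
have exp g : bm g -> E (fun y => g y * u y) =
    2 * K * E (fun y => g y * v y) - K * E (fun y => g y * 1).
  move=> bg.
  have bv' := bounded_meas_sub Dm bv; have b1' := bounded_meas_sub Dm b1.
  rewrite -!expectZ; try exact: bounded_measM.
  rewrite -expectB; try by apply: bounded_measM; [exact: bounded_meas_cst|exact: bounded_measM].
  congr Rintegral; apply/funext => y; rewrite /v.
  by field; rewrite gt_eqF.
by rewrite exp ?exp ?h1 ?h2//; exact: (bounded_meas_sub Dm).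
Qed.

Lemma version_unique D A f g : is_sub_sigma D -> measurable A ->
  is_version D A f -> is_version D A g -> ae_eq nu setT f g.
Proof.
move=> sD mA vf vg; have [bf _ _] := vf; have [bg _ _] := vg; have [_ Dm] := sD.
have bf' := bounded_meas_sub Dm bf; have bg' := bounded_meas_sub Dm bg.
have bh := bounded_measB bf bg; have bh' := bounded_measB bf' bg'.
(* f - g is [D]-measurable, so it has the same integral against f, 1_A and g. *)
apply: (expect_sqr_eq0 bf' bg').
have -> : (fun y => (f y - g y) * (f y - g y)) =
    fun y => f y * (f y - g y) - g y * (f y - g y).
  by apply/funext => y; rewrite mulrBl.
rewrite expectB; try exact: bounded_measM.
by rewrite (version_pullout sD mA vf bh) (version_pullout sD mA vg bh) subrr.
Qed.

End Versions.

(** * Entropy of a cell and its variational formula *)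

Section CellEntropy.
Context {R : realType} {d : measure_display} {Y : measurableType d}.
Context (nu : probability Y R).
Implicit Types (D : set (set Y)) (A S : set Y) (f g q : Y -> R).

Local Notation bm := (@bounded_meas R d Y (@measurable d Y)).
Local Notation E f := (Rintegral nu setT f).

Lemma Rintegral_mul_indic S g :
  \int[nu]_(y in S) g y = E (fun y => g y * \1_S y).
Proof.
rewrite Rintegral_mkcond; congr Rintegral; apply/funext => y.
by rewrite patchE indicE; case: (y \in S); rewrite ?mulr1 ?mulr0.
Qed.

Lemma null_of_neg_integral S g : measurable S ->
  nu.-integrable setT (EFin \o g) -> (forall y, S y -> g y < 0) ->
  (0 <= \int[nu]_(y in S) (g y)%:E)%E -> nu S = 0%E.
Proof.
move=> mS ig gneg int0.
have igS : nu.-integrable S (EFin \o g) by apply: integrableS ig.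
have abs0 : (\int[nu]_(y in S) `|(EFin \o g) y| = 0)%E.
  apply/eqP; rewrite eq_le integral_ge0 ?andbT; last by move=> y _; exact: abse_ge0.
  have -> : (\int[nu]_(y in S) `|(EFin \o g) y| = \int[nu]_(y in S) - (g y)%:E)%E.
    by apply: eq_integral => y /set_mem Sy /=; rewrite ltr0_norm ?gneg.
  have -> : (\int[nu]_(y in S) - (g y)%:E = \int[nu]_(y in S) ((- 1)%:E * (EFin \o g) y))%E.
    by apply: eq_integral => y _; rewrite /= -EFinM mulN1r.
  rewrite integralZl//; apply: mule_le0_ge0 => //.
have mg := measurable_int _ igS.
have [N [mN N0 sub]] := (ae_eq_integral_abs nu mS mg).1 abs0.
apply/eqP; rewrite eq_le measure_ge0 andbT -N0.
apply: le_measure; rewrite ?inE//.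
apply: (subset_trans _ sub) => y Sy /= /(_ Sy) [] gy.
by have := gneg y Sy; rewrite gy ltxx.
Qed.

(** The chosen conditional expectation lies in [0, 1] almost everywhere: the sets
    where it is negative or exceeds 1 belong to [D], and integrating over them
    shows that they are null.  Truncation gives the version. *)
Lemma exists_version D A : is_sub_sigma D -> measurable A ->
  exists f, is_version nu D A f /\ ae_eq nu setT (cond_prob nu D A) f.
Proof.
move=> sDm mA; have [sD Dm] := sDm.
have bA : bm \1_A by exact: bounded_meas_indic.
have iA := bounded_meas_integrable nu bA.
have [mf0 if0 f0E] := cond_expP sDm iA.
rewrite /cond_prob; set f0 := cond_exp _ _ _ in mf0 if0 f0E *.
have mf0' : measurable_fun [set: g_sigma_algebraType D] (f0 : g_sigma_algebraType D -> R).
  by move=> _ B mB; rewrite setTI; apply: sub_sigma_algebra; exact: mf0.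
pose f y := Num.max 0 (Num.min 1 (f0 y)).
have f01 y : 0 <= f y <= 1.
  by rewrite /f le_max lexx/= ge_max ler01 ge_min lexx.
have bf : bounded_meas D f.
  split; last first.
    by exists 1 => y; have /andP[? ?] := f01 y; rewrite ger0_norm.
  apply: (@measurable_maxr _ (g_sigma_algebraType D)); first exact: measurable_cst.
  by apply: measurable_minr => //; exact: measurable_cst.
have bf' := bounded_meas_sub Dm bf.
pose N0 := f0 @^-1` `]-oo, 0[; pose N1 := f0 @^-1` `]1, +oo[.
have DN0 : D N0 by apply: mf0.
have DN1 : D N1 by apply: mf0.
have mN0 := Dm _ DN0; have mN1 := Dm _ DN1.
have N00 : nu N0 = 0%E.
  apply: (null_of_neg_integral mN0 if0).
    by move=> y; rewrite /N0/= in_itv.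
  by rewrite f0E//; apply: integral_ge0 => y _; rewrite lee_fin indicE.
have N10 : nu N1 = 0%E.
  have b1 : bm (fun=> 1) by exact: bounded_meas_cst.
  have i1 := bounded_meas_integrable nu b1.
  have i1f0 : nu.-integrable setT (EFin \o (fun y => 1 - f0 y)).
    by apply: eq_integrable (integrableB measurableT i1 if0) => // y _.
  apply: (null_of_neg_integral mN1 i1f0).
    by move=> y; rewrite /N1/= in_itv/= andbT subr_lt0.
  have i1N : nu.-integrable N1 (EFin \o (fun=> 1)) by exact: integrableS i1.
  have -> : (\int[nu]_(y in N1) (1 - f0 y)%:E =
     \int[nu]_(y in N1) 1%:E - \int[nu]_(y in N1) (f0 y)%:E)%E.
    have if0N : nu.-integrable N1 (EFin \o f0) by exact: integrableS if0.
    by rewrite -(integralB mN1 i1N if0N); apply: eq_integral => y _; rewrite EFinB.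
  rewrite f0E// sube_ge0; last first.
    by apply/orP; right; exact: (integrable_fin_num mN1 i1N).
  apply: ge0_le_integral => //.
  - by apply/measurable_EFinP; exact: measurable_indic.
  - by move=> y _; rewrite lee_fin indicE; case: (_ \in _).
have ff0 : ae_eq nu setT f0 f.
  exists (N0 `|` N1); split.
  - exact: measurableU.
  - by rewrite measureU0.
  - move=> y /= h; apply: contrapT => /not_orP[]; rewrite /N0 /N1/= !in_itv/= andbT.
    move=> /negP; rewrite -leNgt => y0 /negP; rewrite -leNgt => y1; apply: h => _.
    by rewrite /f min_r// max_r.
exists f; split => //; split => // S DS.
rewrite -!Rintegral_mul_indic; have mS := Dm _ DS.
rewrite /Rintegral -f0E//; congr fine; apply: ae_eq_integral => //.
- by apply: measurable_funTS; apply/measurable_EFinP; exact: bounded_meas_measurable.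
- by apply: measurable_funTS; exact: measurable_int if0.
- by apply: filterS ff0 => y /= /(_ I) [] ->.
Qed.

(** The function - x log x, equal to 0 at 0 because [ln 0 = 0]. *)
Definition shannon (x : R) : R := - (x * ln x).

Lemma measurable_shannon : measurable_fun setT shannon.
Proof.
apply: measurable_funN; apply: measurable_funM; first exact: measurable_id.
exact: measurable_ln.
Qed.

(** The tangent line inequality for the concave function [shannon] at [q]. *)
Lemma shannon_le_gibbs (x q : R) : 0 <= x -> 0 < q -> shannon x <= - (x * ln q) + q - x.
Proof.
rewrite le_eqVlt => /predU1P[<- q0|x0 q0].
  by rewrite /shannon !mul0r oppr0 addr0 add0r ltW.
have h : ln (q / x) <= q / x - 1.
  rewrite -[X in ln X](subrK 1) addrC; apply: le_ln1Dx.
  by rewrite ltrBrDr addNr divr_gt0.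
rewrite lnM ?posrE ?invr_gt0// lnV ?posrE// in h.
have := ler_wpM2l (ltW x0) h.
have -> : x * (q / x - 1) = q - x by field; rewrite gt_eqF.
by rewrite /shannon; lra.
Qed.

Lemma shannon_ge0 (x : R) : 0 <= x <= 1 -> 0 <= shannon x.
Proof. by move=> /andP[x0 x1]; rewrite /shannon oppr_ge0 mulr_ge0_le0// ln_le0. Qed.

Lemma shannon_le1 (x : R) : 0 <= x <= 1 -> shannon x <= 1.
Proof.
move=> /andP[x0 x1]; rewrite (le_trans (shannon_le_gibbs x0 ltr01))//.
by rewrite ln1; lra.
Qed.

Lemma bounded_meas_shannon D f : bounded_meas D f -> (forall y, 0 <= f y <= 1) ->
  bounded_meas D (fun y => shannon (f y)).
Proof.
move=> bf f01; apply: (@bounded_meas_comp _ _ _ D shannon f 1) => //.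
  exact: measurable_shannon.
by move=> y; rewrite ger0_norm ?shannon_ge0 ?shannon_le1.
Qed.

(** The contribution of the cell [A] to the entropy given [D]. *)
Definition cell_entropy D A : R :=
  - \int[nu]_y (cond_prob nu D A y * ln (cond_prob nu D A y)).

Lemma cell_entropyE D A f : is_sub_sigma D -> measurable A ->
  is_version nu D A f -> cell_entropy D A = E (fun y => shannon (f y)).
Proof.
move=> sDm mA vf; have [bf f01 _] := vf; have [_ Dm] := sDm.
have bf' := bounded_meas_sub Dm bf.
have be := bounded_meas_shannon bf' f01.
have bN : bm (fun y => f y * ln (f y)).
  have := bounded_measN be; congr bounded_meas; apply/funext => y.
  by rewrite /shannon opprK.
rewrite expectN//; congr (- fine _); have [f1 [vf1 ae1]] := exists_version sDm mA.
have bA : bm \1_A by exact: bounded_meas_indic.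
have [mc _ _] := cond_expP sDm (bounded_meas_integrable nu bA).
have mc' : measurable_fun setT (cond_prob nu D A).
  by move=> _ B mB; rewrite setTI; apply: Dm; exact: mc.
apply: ae_eq_integral => //.
- apply/measurable_EFinP; apply: measurable_funM => //.
  exact: measurableT_comp.
- by apply/measurable_EFinP; exact: bounded_meas_measurable.
- apply: filterS2 (version_unique sDm mA vf1 vf) ae1 => y /= h1 h2 _.
  by rewrite h2// h1.
Qed.

Lemma cell_entropy_ge0 D A : is_sub_sigma D -> measurable A ->
  0 <= cell_entropy D A.
Proof.
move=> sDm mA; have [f [vf _]] := exists_version sDm mA.
rewrite (cell_entropyE sDm mA vf); apply: Rintegral_ge0 => y _.
by apply: shannon_ge0; case: vf.
Qed.

(** The expected cost of predicting the event [A] by the density [q]: a cross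
    entropy, with linear terms that make any normalisation of [q] unnecessary.
    Its infimum over the bounded [D]-measurable [q] that are bounded away from 0
    is [cell_entropy D A]; the two bounds are
    [cell_entropy_le_gibbs] and [gibbs_le_cell_entropy]. *)
Definition gibbs A q : R := E (fun y => q y - \1_A y - \1_A y * ln (q y)).

Lemma bounded_meas_ln D q (r M : R) : 0 < r -> bounded_meas D q ->
  (forall y, r <= q y <= M) -> bounded_meas D (fun y => ln (q y)).
Proof.
move=> r0 bq qM.
apply: (@bounded_meas_comp _ _ _ D (@ln R) q (`|ln r| + `|ln M|)) => // y.
have /andP[h1 h2] := qM y; have q0 := lt_le_trans r0 h1.
have l1 : ln r <= ln (q y) by rewrite ler_ln ?posrE.
have l2 : ln (q y) <= ln M by rewrite ler_ln ?posrE// (lt_le_trans q0).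
rewrite ler_norml; apply/andP; split.
  have := ler_norm (- ln r); rewrite normrN; have := normr_ge0 (ln M); lra.
have := ler_norm (ln M); have := normr_ge0 (ln r); lra.
Qed.

Lemma bounded_meas_gibbs A q (r M : R) : measurable A -> 0 < r -> bm q ->
  (forall y, r <= q y <= M) -> bm (fun y => q y - \1_A y - \1_A y * ln (q y)).
Proof.
move=> mA r0 bq qM; have bA : bm \1_A by exact: bounded_meas_indic.
apply: bounded_measB; first exact: bounded_measB.
apply: bounded_measM => //; exact: bounded_meas_ln qM.
Qed.

(** For a [D]-measurable [q], the event may be replaced by its conditional
    probability. *)
Lemma gibbs_version D A f q (r M : R) : is_sub_sigma D -> measurable A ->
  is_version nu D A f -> 0 < r -> bounded_meas D q ->
  (forall y, r <= q y <= M) ->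
  gibbs A q = E (fun y => q y - f y - f y * ln (q y)).
Proof.
move=> sDm mA vf r0 bq qM; have [_ Dm] := sDm; have [bf _ _] := vf.
have bf' := bounded_meas_sub Dm bf; have bq' := bounded_meas_sub Dm bq.
have bA : bm \1_A by exact: bounded_meas_indic.
have bl := bounded_meas_ln r0 bq qM; have bl' := bounded_meas_sub Dm bl.
have split g : bm g -> E (fun y => q y - g y - g y * ln (q y)) =
    E q - E (fun y => g y * 1) - E (fun y => g y * ln (q y)).
  move=> bg; rewrite expectB; [|exact: bounded_measB|exact: bounded_measM].
  rewrite expectB//; congr (_ - _ - _).
  by congr Rintegral; apply/funext => y; rewrite mulr1.
have b1 : bounded_meas D (fun=> 1 : R) by exact: bounded_meas_cst.
rewrite /gibbs !split//.
by rewrite (version_pullout sDm mA vf b1) (version_pullout sDm mA vf bl).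
Qed.

(** Upper bound of the variational formula, for every competitor [q]. *)
Lemma cell_entropy_le_gibbs D A q (r M : R) : is_sub_sigma D -> measurable A ->
  0 < r -> bounded_meas D q -> (forall y, r <= q y <= M) ->
  cell_entropy D A <= gibbs A q.
Proof.
move=> sDm mA r0 bq qM; have [f [vf _]] := exists_version sDm mA.
have [_ Dm] := sDm; have [bf f01 _] := vf.
have bf' := bounded_meas_sub Dm bf; have bq' := bounded_meas_sub Dm bq.
rewrite (cell_entropyE sDm mA vf) (gibbs_version sDm mA vf r0 bq qM).
apply: expect_le; first exact: bounded_meas_shannon.
  apply: bounded_measB; first exact: bounded_measB.
  apply: bounded_measM => //; exact: bounded_meas_ln qM.
move=> y; have /andP[f0 _] := f01 y; have /andP[rq _] := qM y.
by have := shannon_le_gibbs f0 (lt_le_trans r0 rq); lra.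
Qed.

(** Near optimality of the conditional probability itself, shifted by [r] so that
    its logarithm stays bounded. *)
Lemma gibbs_le_cell_entropy D A f (r : R) : is_sub_sigma D -> measurable A ->
  is_version nu D A f -> 0 < r ->
  gibbs A (fun y => f y + r) <= cell_entropy D A + r.
Proof.
move=> sDm mA vf r0; have [_ Dm] := sDm; have [bf f01 _] := vf.
have bf' := bounded_meas_sub Dm bf.
have br D0 : @bounded_meas R d Y D0 (fun=> r) by exact: bounded_meas_cst.
have bq := bounded_measD bf (br D).
have bq' := bounded_measD bf' (br _).
have qM y : r <= f y + r <= 1 + r by have := f01 y; lra.
rewrite (gibbs_version sDm mA vf r0 bq qM) (cell_entropyE sDm mA vf).
have be := bounded_meas_shannon bf' f01.
rewrite -[X in _ <= _ + X](expect_cst nu r) -expectD//; apply: expect_le.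
- apply: bounded_measB; first exact: bounded_measB.
  apply: bounded_measM => //; exact: bounded_meas_ln qM.
- exact: bounded_measD.
- move=> y; have /andP[f0 _] := f01 y; rewrite /shannon.
  move: f0; rewrite le_eqVlt => /predU1P[<-|f0]; first by rewrite !mul0r; lra.
  have : ln (f y) <= ln (f y + r) by rewrite ler_ln ?posrE//; lra.
  by move/(ler_wpM2l (ltW f0)); lra.
Qed.

Lemma ln_dist_le (r a b : R) : 0 < r -> r <= a -> r <= b ->
  ln a - ln b <= `|a - b| / r.
Proof.
move=> r0 ra rb; have a0 := lt_le_trans r0 ra; have b0 := lt_le_trans r0 rb.
have h : ln (a / b) <= a / b - 1.
  rewrite -[X in ln X](subrK 1) addrC; apply: le_ln1Dx.
  by rewrite ltrBrDr addNr divr_gt0.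
rewrite lnM ?posrE ?invr_gt0// lnV ?posrE// in h.
rewrite (le_trans h)//.
have -> : a / b - 1 = (a - b) / b by field; rewrite gt_eqF.
rewrite (le_trans (ler_norm _))// normrM ler_wpM2l// ger0_norm ?invr_ge0 ?(ltW b0)//.
by rewrite lef_pV2 ?posrE.
Qed.

Lemma gibbs_lipschitz A f g (r : R) : measurable A -> 0 < r ->
  bm f -> bm g -> (forall y, 0 <= f y <= 1) -> (forall y, 0 <= g y <= 1) ->
  gibbs A (fun y => g y + r) <=
  gibbs A (fun y => f y + r) + (1 + r^-1) * E (fun y => `|f y - g y|).
Proof.
move=> mA r0 bf bg f01 g01.
have br : bm (fun=> r) by exact: bounded_meas_cst.
have fr y : r <= f y + r <= 1 + r by have := f01 y; lra.
have gr y : r <= g y + r <= 1 + r by have := g01 y; lra.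
have bfr := bounded_measD bf br; have bgr := bounded_measD bg br.
have b1 := bounded_meas_norm (bounded_measB bf bg).
have b2 : bm (fun y => (1 + r^-1) * `|f y - g y|).
  by apply: bounded_measM => //; exact: bounded_meas_cst.
have b3 := bounded_meas_gibbs mA r0 bfr fr.
have b4 := bounded_meas_gibbs mA r0 bgr gr.
rewrite -expectZ// -expectD//; apply: expect_le => //; first exact: bounded_measD.
move=> y; have /andP[h1 _] := fr y; have /andP[h2 _] := gr y.
have := ln_dist_le r0 h1 h2.
have -> : f y + r - (g y + r) = f y - g y by ring.
move=> hl; have hn := ler_norm (- (f y - g y)); rewrite normrN in hn.
have hn0 : 0 <= `|f y - g y| / r by rewrite divr_ge0// ltW.
rewrite indicE; case: (y \in A) => /=; lra.
Qed.

End CellEntropy.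

(** * Dependence of the entropy on the conditioning sigma-algebra *)

Section Approximation.
Context {R : realType} {d : measure_display} {Y : measurableType d}.
Context (nu : probability Y R).
Implicit Types (D : set (set Y)) (A B S : set Y) (f g q : Y -> R).

Local Notation bm := (@bounded_meas R d Y (@measurable d Y)).
Local Notation E f := (Rintegral nu setT f).

(** The measure of the symmetric difference, as the L1 distance of indicators. *)
Definition set_dist A B : R := E (fun y => `|\1_A y - \1_B y|).

(** [S] is within [e] of a set of [D]. *)
Definition approximable D S (e : R) : Prop :=
  exists2 B, D B & set_dist S B <= e.

Lemma bounded_meas_set_dist A B : measurable A -> measurable B ->
  bm (fun y => `|\1_A y - \1_B y|).
Proof.
by move=> mA mB; apply/bounded_meas_norm/bounded_measB; exact: bounded_meas_indic.
Qed.

Lemma set_dist_refl A : set_dist A A = 0.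
Proof.
rewrite -[RHS](expect_cst nu 0); congr Rintegral; apply/funext => y.
by rewrite subrr normr0.
Qed.

Lemma set_dist_null_eq A B : measurable A -> measurable B ->
  null_eq nu A B -> set_dist A B = 0.
Proof.
move=> mA mB nAB; rewrite /set_dist.
have -> : (fun y => `|\1_A y - \1_B y|) = \1_((A `\` B) `|` (B `\` A)) :> (Y -> R).
  apply/funext => y; rewrite !indicE in_setU !in_setD.
  by case: (y \in A); case: (y \in B); rewrite /= ?subrr ?subr0 ?sub0r ?normrN ?normr0 ?normr1.
by rewrite expect_indic ?nAB//; apply: measurableU; exact: measurableD.
Qed.

Lemma staircase_approx D f (m : nat) (e : R) : is_sub_sigma D -> bm f ->
  (forall y, 0 <= f y <= 1) -> (0 < m)%N ->
  (forall j : nat, (j < m)%N -> approximable D (level f m j) e) ->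
  exists g, [/\ bounded_meas D g, forall y, 0 <= g y <= 1 &
    E (fun y => `|f y - g y|) <= m%:R^-1 + e].
Proof.
move=> [sD Dm] bf f01 m0 app.
have m0' : 0 < m%:R :> R by rewrite ltr0n.
have /choice[B hB] : forall j : 'I_m, exists B, D B /\ set_dist (level f m j) B <= e.
  by move=> j; have [B ? ?] := app j (ltn_ord j); exists B.
pose g y : R := \sum_(j < m) m%:R^-1 * \1_(B j) y.
pose s y : R := \sum_(j < m) m%:R^-1 * \1_(level f m j) y.
have mL j : measurable (level f m j).
  by apply: bounded_meas_level => //; exact: sigma_algebra_measurable.
have mB j : measurable (B j) by apply: Dm; have [] := hB j.
have bg : bounded_meas D g.
  apply: bounded_meas_sum => j _; apply: bounded_measM; first exact: bounded_meas_cst.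
  by apply: bounded_meas_indic; have [] := hB j.
have bg' := bounded_meas_sub Dm bg.
have bs : bm s.
  apply: bounded_meas_sum => j _; apply: bounded_measM; first exact: bounded_meas_cst.
  exact: bounded_meas_indic.
exists g; split => //.
- move=> y; rewrite /g -mulr_sumr mulr_ge0 ?invr_ge0 ?ler0n//=; last first.
    by apply: sumr_ge0 => j _; rewrite indicE.
  rewrite mulrC ler_pdivrMr// mul1r.
  apply: (@le_trans _ _ (\sum_(j < m) 1)); last by rewrite sumr_const card_ord.
  by apply: ler_sum => j _; rewrite indicE; case: (_ \in _).
- pose t y : R := m%:R^-1 + m%:R^-1 * \sum_(j < m) `|\1_(level f m j) y - \1_(B j) y|.
  have bsum : bm (fun y => \sum_(j < m) `|\1_(level f m j) y - \1_(B j) y|).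
    by apply: bounded_meas_sum => j _; exact: bounded_meas_set_dist.
  have bmS : bm (fun y => m%:R^-1 * \sum_(j < m) `|\1_(level f m j) y - \1_(B j) y|).
    by apply: bounded_measM => //; exact: bounded_meas_cst.
  have bt : bm t by apply: bounded_measD => //; exact: bounded_meas_cst.
  apply: (@le_trans _ _ (E t)).
    apply: expect_le => //; first by apply: bounded_meas_norm; exact: bounded_measB.
    move=> y; apply: (le_trans (ler_distD (s y) _ _)); apply: lerD.
      exact: staircase_dist.
    rewrite /s /g -sumrB mulr_sumr; apply: (le_trans (ler_norm_sum _ _ _)).
    by apply: ler_sum => j _; rewrite -mulrBr normrM ger0_norm ?invr_ge0 ?ler0n.
  rewrite /t expectD//; last exact: bounded_meas_cst.
  rewrite expect_cst expectZ// expect_sum; last by move=> j _; exact: bounded_meas_set_dist.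
  rewrite lerD2l mulrC ler_pdivrMr//.
  apply: (@le_trans _ _ (\sum_(j < m) e)).
    by apply: ler_sum => j _; have [] := hB j.
  by rewrite sumr_const card_ord mulr_natr.
Qed.

(** If [f] is an almost optimal predictor of [A], for whatever reason, then a
    sigma-algebra containing good approximations of finitely many level sets of
    [f] yields almost the same entropy.  No inclusion between sigma-algebras is
    involved, which is why this one statement gives monotonicity, continuity
    along a directed family, and insensitivity to null sets. *)
Lemma cell_entropy_approx A f (c e : R) : measurable A -> bm f ->
  (forall y, 0 <= f y <= 1) ->
  (forall r, 0 < r -> gibbs nu A (fun y => f y + r) <= c + r) -> 0 < e ->
  exists m r, [/\ (0 < m)%N, 0 < r & forall D, is_sub_sigma D ->
    (forall j : nat, (j < m)%N -> approximable D (level f m j) r) ->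
    cell_entropy nu D A <= c + e].
Proof.
move=> mA bf f01 hc e0; pose s := e / 2; have s0 : 0 < s by rewrite divr_gt0.
pose L := 1 + s^-1; have L0 : 0 < L by rewrite ltr_wpDl ?ler01// invr_gt0.
(* Shifting by s costs s = e / 2; an L1 error of at most 2 r costs L * 2 r = e / 2. *)
pose r := e / (4 * L); have r0 : 0 < r by rewrite divr_gt0// mulr_gt0.
pose m := (Num.truncn r^-1).+1.
have mr : m%:R^-1 <= r.
  by rewrite -[leRHS]invrK lef_pV2 ?posrE ?invr_gt0// ltW// truncnS_gt.
exists m, r; split => // D sDm app; have [_ Dm] := sDm.
have [g [bg g01 fg]] := staircase_approx sDm bf f01 (ltn0Sn _) app.
have bg' := bounded_meas_sub Dm bg.
have bq : bounded_meas D (fun y => g y + s).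
  by apply: bounded_measD => //; exact: bounded_meas_cst.
have qM y : s <= g y + s <= 1 + s by have := g01 y; lra.
apply: (le_trans (cell_entropy_le_gibbs nu sDm mA s0 bq qM)).
apply: (le_trans (gibbs_lipschitz nu mA s0 bf bg' f01 g01)).
have h1 := hc s s0.
have h2 : L * E (fun y => `|f y - g y|) <= L * (r + r).
  by apply: ler_wpM2l; [exact: ltW|apply: (le_trans fg); rewrite lerD2r].
have h3 : L * (r + r) = e / 2 by rewrite /r; field; rewrite gt_eqF.
rewrite -/L; rewrite h3 in h2; have -> : e = s + e / 2 by rewrite /s -splitr.
by rewrite addrA lerD.
Qed.

(** Monotonicity, also when [D] lies in [D'] only up to sets of arbitrarily small measure. *)
Lemma cell_entropy_le D D' A : is_sub_sigma D -> is_sub_sigma D' ->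
  measurable A -> (forall S e, D S -> 0 < e -> approximable D' S e) ->
  cell_entropy nu D' A <= cell_entropy nu D A.
Proof.
move=> sD sD' mA app; have [f [vf _]] := exists_version nu sD mA.
have [bf f01 _] := vf; have bf' := bounded_meas_sub sD.2 bf.
apply/ler_addgt0Pl => e e0; rewrite addrC.
have [m [r [m0 r0 h]]] := cell_entropy_approx mA bf' f01
   (fun r => gibbs_le_cell_entropy sD mA vf (r := r)) e0.
apply: h => // j _; apply: app => //.
by apply: bounded_meas_level bf; case: sD.
Qed.

Lemma cond_entropyE (P : {fset (set Y)}) D :
  cond_entropy nu P D = \sum_(A <- P) cell_entropy nu D A.
Proof. by rewrite /cond_entropy -sumrN. Qed.

Lemma cond_entropy_ge0 (P : {fset (set Y)}) D : is_sub_sigma D ->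
  (forall A, A \in P -> measurable A) -> 0 <= cond_entropy nu P D.
Proof.
move=> sD mP; rewrite cond_entropyE big_seq; apply: sumr_ge0 => A AP.
by apply: cell_entropy_ge0 => //; exact: mP.
Qed.

Lemma cond_entropy_sub (P : {fset (set Y)}) D D' : is_sub_sigma D ->
  is_sub_sigma D' -> (forall A, A \in P -> measurable A) -> D `<=` D' ->
  cond_entropy nu P D' <= cond_entropy nu P D.
Proof.
move=> sD sD' mP DD'; rewrite !cond_entropyE big_seq [leRHS]big_seq.
apply: ler_sum => A AP; apply: cell_entropy_le => //; first exact: mP.
by move=> S e DS e0; exists S; [exact: DD'|rewrite set_dist_refl ltW].
Qed.

Lemma cell_entropy_set0 D : is_sub_sigma D -> cell_entropy nu D set0 = 0.
Proof.
move=> sD; apply/eqP; rewrite eq_le cell_entropy_ge0 ?andbT//.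
apply/ler_addgt0Pl => e e0; rewrite addr0.
have bq : bounded_meas D (fun=> e) by exact: bounded_meas_cst.
apply: (le_trans (cell_entropy_le_gibbs nu sD measurable0 e0 bq (M := e) _)).
  by move=> y; rewrite lexx.
rewrite /gibbs -[leRHS](expect_cst nu e) le_eqVlt.
apply/orP; left; apply/eqP; congr Rintegral.
by apply/funext => y; rewrite indic0 /= mul0r !subr0.
Qed.

Lemma cell_entropy_setT D : is_sub_sigma D -> cell_entropy nu D setT = 0.
Proof.
move=> sD; apply/eqP; rewrite eq_le cell_entropy_ge0 ?andbT//.
have bq : bounded_meas D (fun=> 1 : R) by exact: bounded_meas_cst.
apply: (le_trans (cell_entropy_le_gibbs nu sD measurableT ltr01 bq (M := 1) _)).
  by move=> y; rewrite lexx.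
rewrite /gibbs -[leRHS](expect_cst nu 0) le_eqVlt.
apply/orP; left; apply/eqP; congr Rintegral.
by apply/funext => y; rewrite indicT /= ln1 mulr0 subr0 subrr.
Qed.

(** Finitely many upward closed properties of finite sets, each of them
    satisfiable, are satisfied simultaneously. *)
Lemma finite_upward (G : choiceType) (I : eqType) (s : seq I)
  (Q : I -> {fset G} -> Prop) :
  (forall i (K L : {fset G}), Q i K -> (K `<=` L)%fset -> Q i L) ->
  (forall i, i \in s -> exists K, Q i K) ->
  exists K, forall i, i \in s -> Q i K.
Proof.
move=> up; elim: s => [|i s ih] ex; first by exists fset0.
have [K hK] : exists K, Q i K by apply: ex; rewrite mem_head.
have [|L hL] := ih; first by move=> j js; apply: ex; rewrite inE js orbT.
exists (K `|` L)%fset => j; rewrite inE => /predU1P[->|js].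
  by apply: up hK _; exact: fsubsetUl.
by apply: up (hL j js) _; exact: fsubsetUr.
Qed.

(** Continuity of the entropy along an increasing directed family of
    sigma-algebras that approximates [D]. *)
Lemma cond_entropy_directed (G : choiceType) (D_ : {fset G} -> set (set Y)) D
  (P : {fset (set Y)}) (e : R) :
  is_sub_sigma D -> (forall K, is_sub_sigma (D_ K)) ->
  (forall K L, (K `<=` L)%fset -> D_ K `<=` D_ L) ->
  (forall S r, D S -> 0 < r -> exists K, approximable (D_ K) S r) ->
  (forall A, A \in P -> measurable A) -> 0 < e ->
  exists K, cond_entropy nu P (D_ K) <= cond_entropy nu P D + e.
Proof.
move=> sD sD_ D_mono app mP e0.
pose N : R := (size P).+1%:R; have N0 : 0 < N by rewrite ltr0n.
have [|A AP|K hK] := @finite_upward G _ (P : seq (set Y)) (fun A K => measurable A ->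
    cell_entropy nu (D_ K) A <= cell_entropy nu D A + e / N).
- move=> A K L h KL mA; apply: le_trans (h mA); apply: cell_entropy_le => //.
  by move=> S r DS r0; exists S; [exact: D_mono DS|rewrite set_dist_refl ltW].
- have mA := mP A AP; have [f [vf _]] := exists_version nu sD mA.
  have [bf f01 _] := vf; have bf' := bounded_meas_sub sD.2 bf.
  have eN0 : 0 < e / N by rewrite divr_gt0.
  have [m [r [m0 r0 h]]] := cell_entropy_approx mA bf' f01
     (fun r => gibbs_le_cell_entropy sD mA vf (r := r)) eN0.
  have [|j _|K hK] := @finite_upward G _ (iota 0 m)
      (fun j K => approximable (D_ K) (level f m j) r).
  + by move=> j K L [B DB Bd] KL; exists B => //; exact: D_mono DB.
  + by apply: app => //; apply: bounded_meas_level bf; case: sD.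
  + by exists K => _; apply: h => // j jm; apply: hK; rewrite mem_iota.
- exists K; rewrite !cond_entropyE.
  apply: (@le_trans _ _ (\sum_(A <- P) (cell_entropy nu D A + e / N))).
    by rewrite big_seq [leRHS]big_seq; apply: ler_sum => A AP; apply: hK => //; exact: mP.
  rewrite big_split/= lerD2l big_const_seq count_predT iter_addr_0 -mulr_natl.
  rewrite mulrCA ler_piMr ?(ltW e0)// ler_pdivrMr// mul1r ler_nat//.
Qed.

Lemma expect_preserving (T : Y -> Y) f : measurable_fun setT T ->
  (forall A, measurable A -> nu (T @^-1` A) = nu A) -> bm f ->
  E (fun y => f (T y)) = E f.
Proof.
move=> mT pT bf; rewrite /Rintegral; congr fine.
have mf := bounded_meas_measurable bf.
have bfT : bm (fun y => f (T y)).
  split; last by case: bf => _ [M fM]; exists M => y.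
  move=> _ B mB; rewrite setTI; apply: sub_sigma_algebra.
  by rewrite -[X in measurable X]setTI; apply: (measurableT_comp mf mT).
have := @integral_pushforward _ _ Y Y R T mT nu setT (EFin \o f).
rewrite preimage_setT => h; rewrite -[LHS]h//.
- by apply: eq_measure_integral => A mA _; exact: pT.
- by apply/measurable_EFinP.
- exact: bounded_meas_integrable.
Qed.

(** If [f] predicts [A], then [f] composed with [T] predicts the preimage of [A]
    equally well, and its level sets agree with sets of [D] up to null sets. *)
Lemma cell_entropy_preimage (T : Y -> Y) D A : measurable_fun setT T ->
  (forall A, measurable A -> nu (T @^-1` A) = nu A) ->
  is_sub_sigma D -> measurable A ->
  (forall S, D S -> exists2 B, D B & null_eq nu (T @^-1` S) B) ->
  cell_entropy nu D (T @^-1` A) <= cell_entropy nu D A.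
Proof.
move=> mT pT sD mA inv; have [f [vf _]] := exists_version nu sD mA.
have [bf f01 _] := vf; have bf' := bounded_meas_sub sD.2 bf.
have mpre B : measurable B -> measurable (T @^-1` B).
  by move=> mB; rewrite -[_ @^-1` _]setTI; exact: mT.
have bfT : bm (fun y => f (T y)).
  split; last by case: bf => _ [M fM]; exists M => y.
  move=> _ B mB; rewrite setTI; apply: sub_sigma_algebra.
  apply: (mpre (f @^-1` B)); rewrite -[X in measurable X]setTI.
  exact: (bounded_meas_measurable bf').
apply/ler_addgt0Pl => e e0; rewrite addrC.
have hc (r : R) : 0 < r ->
    gibbs nu (T @^-1` A) (fun y => f (T y) + r) <= cell_entropy nu D A + r.
  move=> r0; apply: le_trans (gibbs_le_cell_entropy sD mA vf r0).
  have bfr : bm (fun y => f y + r).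
    by apply: bounded_measD => //; exact: bounded_meas_cst.
  have fr y : r <= f y + r <= 1 + r by have := f01 y; lra.
  by rewrite /gibbs -(expect_preserving mT pT (bounded_meas_gibbs mA r0 bfr fr)).
have [m [r [m0 r0 h]]] := cell_entropy_approx (mpre _ mA) bfT (fun y => f01 (T y)) hc e0.
apply: h => // j _.
have DL : D (level f m j) by apply: bounded_meas_level bf; case: sD.
have [B DB nB] := inv _ DL; exists B => //.
rewrite set_dist_null_eq ?ltW//; last exact: sD.2.
by apply: (mpre (level f m j)); exact: sD.2.
Qed.

End Approximation.

(** * Sigma-algebras generated by partitions *)

Section SubSigma.
Context {d : measure_display} {Y : measurableType d}.
Implicit Types (C D : set (set Y)) (P Q : {fset (set Y)}).

Lemma generated_is_sub_sigma D : D `<=` measurable -> is_sub_sigma <<s D >>.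
Proof.
move=> Dm; split; first exact: smallest_sigma_algebra.
by apply: smallest_sub => //; exact: sigma_algebra_measurable.
Qed.

Lemma is_sub_sigma_join C D : C `<=` measurable -> D `<=` measurable ->
  is_sub_sigma (sigma_join C D).
Proof. by move=> Cm Dm; apply: generated_is_sub_sigma; rewrite subUset. Qed.

Lemma part_sigma_measurable P : measurable_partition P ->
  part_sigma P `<=` measurable.
Proof.
by move=> [mP _ _]; apply: (generated_is_sub_sigma _).2 => A /= /mP.
Qed.

Lemma sigma_join_sub C C' D : C `<=` C' -> sigma_join C D `<=` sigma_join C' D.
Proof. by move=> CC; apply: sub_sigma_algebra2; apply: setSU. Qed.

Lemma sub_sigma_joinl C D : C `<=` sigma_join C D.
Proof. by move=> A CA; apply: sub_sigma_algebra; left. Qed.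

Lemma sub_sigma_joinr C D : D `<=` sigma_join C D.
Proof. by move=> A CA; apply: sub_sigma_algebra; right. Qed.

Lemma part_joinP P Q S :
  reflect (exists A B, [/\ A \in P, B \in Q & S = A `&` B]) (S \in part_join P Q).
Proof.
apply: (iffP idP) => [/imfset2P[A AP [B BQ ->]]|[A [B [AP BQ ->]]]].
  by exists A, B.
by apply/imfset2P; exists A => //; exists B.
Qed.

Lemma measurable_partition_join P Q : measurable_partition P ->
  measurable_partition Q -> measurable_partition (part_join P Q).
Proof.
move=> [mP dP cP] [mQ dQ cQ]; split.
- by move=> _ /part_joinP[A [B [AP BQ ->]]]; apply: measurableI; [exact: mP|exact: mQ].
- move=> _ _ /part_joinP[A [B [AP BQ ->]]] /part_joinP[A' [B' [AP' BQ' ->]]] neq.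
  have [AA|AA] := eqVneq A A'; last first.
    by rewrite setIACA (dP A A')// set0I.
  have [BB|BB] := eqVneq B B'; last by rewrite setIACA (dQ B B')// setI0.
  by move: neq; rewrite AA BB eqxx.
- apply/seteqP; split => // y _.
  have [A /= AP Ay] : (\bigcup_(A in [set` P]) A) y by rewrite cP.
  have [B /= BQ By] : (\bigcup_(A in [set` Q]) A) y by rewrite cQ.
  by exists (A `&` B) => //=; apply/part_joinP; exists A, B.
Qed.

Lemma part_sigma_join_sub P Q : measurable_partition Q ->
  part_sigma P `<=` part_sigma (part_join P Q).
Proof.
move=> [_ _ cQ]; apply: smallest_sub; first exact: smallest_sigma_algebra.
move=> A /= AP; have -> : A = \bigcup_(B in [set` Q]) (A `&` B).
  by rewrite -setI_bigcupr cQ setIT.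
have sQ := @smallest_sigma_algebra _ setT [set` part_join P Q].
rewrite /part_sigma -(measurable_g_measurableTypeE sQ).
apply: (@fin_bigcup_measurable _ (g_sigma_algebraType (part_sigma (part_join P Q)))).
  exact: finite_fset.
move=> B /= BQ; apply: sub_sigma_algebra; apply: sub_sigma_algebra => /=.
by apply/part_joinP; exists A, B.
Qed.

(** Each point lies in exactly one cell, so that a sum against the indicators of
    the cells has a single term. *)
Lemma partition_cell (R : realType) Q y :
  measurable_partition Q ->
  exists2 B, B \in Q & [/\ B y, forall B', B' \in Q -> B' y -> B' = B &
    forall h : set Y -> R, \sum_(B' <- Q) \1_B' y * h B' = h B].
Proof.
move=> [_ dQ cQ].
have [B /= BQ By] : (\bigcup_(A in [set` Q]) A) y by rewrite cQ.
have uB B' : B' \in Q -> B' y -> B' = B.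
  move=> B'Q B'y; apply/eqP; apply: contraT => /(dQ _ _ B'Q BQ) B0.
  by have : (B' `&` B) y by []; rewrite B0.
exists B => //; split => // k.
rewrite (big_fsetD1 B)//= indicE mem_set// mul1r big_seq big1 ?addr0// => B'.
rewrite !inE => /andP[B'B B'Q]; rewrite indicE memNset ?mul0r// => B'y.
by rewrite (uB B')// eqxx in B'B.
Qed.

(** The sets of the join are obtained by gluing one set of [C] on each cell
    of [Q]. *)
Lemma sigma_joinP Q C S : is_sub_sigma C -> measurable_partition Q ->
  sigma_join (part_sigma Q) C S ->
  exists2 D : set Y -> set Y, (forall B, C (D B)) &
    S = \bigcup_(B in [set` Q]) (B `&` D B).
Proof.
move=> [[C0 CC CU] Cm] [_ dQ cQ].
pose K : set (set Y) := [set S | exists2 D : set Y -> set Y, (forall B, C (D B)) &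
    S = \bigcup_(B in [set` Q]) (B `&` D B)].
have sK : sigma_algebra setT K.
  split.
  - exists (fun=> set0) => //; apply/esym/bigcup0 => B _; exact: setI0.
  - move=> _ [D CD ->]; exists (fun B => setT `\` D B) => [B|]; first exact: CC.
    apply/seteqP; split => y /=.
      move=> [_ ny]; have [B /= BQ By] : (\bigcup_(A in [set` Q]) A) y by rewrite cQ.
      by exists B => //; split => //; split => // DBy; apply: ny; exists B.
    move=> [B /= BQ [By [_ nD]]]; split => // -[B' /= B'Q [B'y D'y]]; apply: nD.
    suff -> : B = B' by [].
    apply/eqP; apply: contraT => /(dQ _ _ BQ B'Q) B0.
    by have : (B `&` B') y by []; rewrite B0.
  - move=> F KF; have /choice[D hD] n : exists D : set Y -> set Y,
      (forall B, C (D B)) /\ F n = \bigcup_(B in [set` Q]) (B `&` D B).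
      by have [D ? ?] := KF n; exists D.
    exists (fun B => \bigcup_n D n B) => [B|].
      by apply: CU => n; have [] := hD n.
    apply/seteqP; split => y /=.
      move=> [n _]; rewrite (hD n).2 => -[B /= BQ [By DBy]].
      by exists B => //; split => //; exists n.
    move=> [B /= BQ [By [n _ DBy]]]; exists n => //; rewrite (hD n).2.
    by exists B.
suff : sigma_join (part_sigma Q) C `<=` K by apply.
apply: smallest_sub => //; rewrite subUset; split.
  apply: smallest_sub => // B /= BQ.
  exists (fun B' => if B' == B then setT else set0) => [B'|].
    case: ifP => // _; have := CC _ C0; by rewrite setD0.
  apply/seteqP; split => y /=; first by move=> By; exists B => //=; rewrite eqxx.
  by move=> [B' /= _]; case: eqP => [->[]|_ []].
move=> S' CS'; exists (fun=> S') => //.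
by rewrite -setI_bigcupl cQ setTI.
Qed.


End SubSigma.

(** * The chain rule *)

Section Ratio.
Context {R : realType}.
Implicit Types r q : R.

(** The quotient r / q, clipped to [0, 1], and 0 when [r] is 0.  The exponential
    form makes its measurability immediate; it is the quotient when 0 < r <= q. *)
Definition ratio r q : R := Num.min 1 (if 0 < r then expR (ln r - ln q) else 0).

Lemma ratio01 r q : 0 <= ratio r q <= 1.
Proof.
rewrite /ratio ge_min lexx/= andbT le_min ler01/=.
by case: ifP => // _; exact: expR_ge0.
Qed.

Lemma ratioE r q : 0 < r -> r <= q -> ratio r q = expR (ln r - ln q).
Proof.
move=> r0 rq; rewrite /ratio r0 min_r// -[leRHS]expR0 ler_expR subr_le0.
by rewrite ler_ln ?posrE// (lt_le_trans r0).
Qed.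

Lemma ratio0 q : ratio 0 q = 0.
Proof. by rewrite /ratio ltxx min_r. Qed.

Lemma mul_ratio r q : 0 <= r -> r <= q -> q * ratio r q = r.
Proof.
rewrite le_eqVlt => /predU1P[<- _|r0 rq]; first by rewrite ratio0 mulr0.
have q0 := lt_le_trans r0 rq.
by rewrite ratioE// expRB !lnK ?posrE// mulrCA divff ?mulr1// gt_eqF.
Qed.

(** The pointwise form of the chain rule. *)
Lemma mul_shannon_ratio r q : 0 <= r -> r <= q ->
  q * shannon (ratio r q) = shannon r + r * ln q.
Proof.
rewrite le_eqVlt => /predU1P[<- _|r0 rq].
  by rewrite ratio0 /shannon !mul0r oppr0 mulr0 addr0.
rewrite /shannon mulrN mulrA mul_ratio ?(ltW r0)// ratioE// expRK; ring.
Qed.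

Lemma bounded_meas_ratio d (Y : measurableType d) (D : set (set Y)) (f g : Y -> R) :
  bounded_meas D f -> bounded_meas D g ->
  bounded_meas D (fun y => ratio (f y) (g y)).
Proof.
move=> [mf _] [mg _]; split; last first.
  by exists 1 => y; have /andP[h1 h2] := ratio01 (f y) (g y); rewrite ger0_norm.
apply: (@measurable_minr _ (g_sigma_algebraType D)); first exact: measurable_cst.
apply: measurable_fun_ifT.
- by apply: measurable_fun_ltr => //; exact: measurable_cst.
- apply: measurableT_comp; first exact: measurable_expR.
  by apply: measurable_funB; apply: measurableT_comp => //; exact: measurable_ln.
- exact: measurable_cst.
Qed.

End Ratio.

Section ChainRule.
Context {R : realType} {d : measure_display} {Y : measurableType d}.
Context (nu : probability Y R).
Implicit Types (C D : set (set Y)) (A B S : set Y) (P Q : {fset (set Y)}).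

Local Notation bm := (@bounded_meas R d Y (@measurable d Y)).
Local Notation E f := (Rintegral nu setT f).

(** A nonempty cell of the join comes from a single pair of cells; the empty set
    may come from several, whence the hypothesis on [h]. *)
Lemma sum_part_join P Q (h : set Y -> R) : measurable_partition P ->
  measurable_partition Q -> h set0 = 0 ->
  \sum_(S <- part_join P Q) h S = \sum_(A <- P) \sum_(B <- Q) h (A `&` B).
Proof.
move=> [_ dP _] [_ dQ _] h0.
have drop0 (s : seq (set Y)) :
    \sum_(S <- s) h S = \sum_(S <- [seq S <- s | S != set0]) h S.
  rewrite big_filter [RHS]big_mkcond/=; apply: eq_bigr => S _.
  by case: eqP => // ->.
have -> : \sum_(A <- P) \sum_(B <- Q) h (A `&` B) =
    \sum_(S <- [seq p.1 `&` p.2 | p <- [seq (A, B) | A <- P, B <- Q]]) h S.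
  by rewrite big_map big_allpairs.
rewrite [LHS]drop0 [RHS]drop0; apply: perm_big; apply: uniq_perm.
- by apply: filter_uniq; exact: fset_uniq.
- rewrite filter_map map_inj_in_uniq; last first.
    move=> [A B] [A' B']; rewrite !mem_filter/= => /andP[/set0P[y [Ay By]] +] /andP[_ +] eAB.
    have [A'y B'y] : (A' `&` B') y by rewrite -eAB.
    move=> /allpairsP[[a b] [/= aP bQ [ea eb]]] /allpairsP[[a' b'] [/= a'P b'Q [ea' eb']]].
    subst a b a' b'; congr pair; apply/eqP; apply: contraT.
      by move=> /(dP _ _ aP a'P) AA0; have : (A `&` A') y by []; rewrite AA0.
    by move=> /(dQ _ _ bQ b'Q) BB0; have : (B `&` B') y by []; rewrite BB0.
  by apply: filter_uniq; apply: allpairs_uniq; rewrite ?fset_uniq// => -[? ?] [? ?] _ _ [-> ->].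
- move=> S; rewrite !mem_filter; congr (_ && _); apply/part_joinP/mapP.
    by move=> [A [B [AP BQ ->]]]; exists (A, B) => //; apply/allpairsP; exists (A, B).
  by move=> [_ /allpairsP[[A B] [/= AP BQ ->]] ->]; exists A, B.
Qed.

(** Given [Q] and [C], the conditional probability of [A] on a cell [B] of [Q] is
    P(A and B | C) / P(B | C).  Integrating [mul_shannon_ratio] and summing over
    the cells gives the identity. *)
Lemma chain_rule C P Q : is_sub_sigma C -> measurable_partition P ->
  measurable_partition Q ->
  cond_entropy nu (part_join P Q) C =
  cond_entropy nu Q C + cond_entropy nu P (sigma_join (part_sigma Q) C).
Proof.
move=> sC pP pQ; have [sgC Cm] := sC.
have [mP dP cP] := pP; have [mQ dQ cQ] := pQ.
set D := sigma_join _ _.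
have sD : is_sub_sigma D by apply: is_sub_sigma_join => //; exact: part_sigma_measurable.
have CD : C `<=` D by exact: sub_sigma_joinr.
have QD B : B \in Q -> D B.
  by move=> BQ; apply: sub_sigma_joinl; exact: sub_sigma_algebra.
have /choice[v hv] A : exists f, [/\ bounded_meas C f, forall y, 0 <= f y <= 1 &
    measurable A -> is_version nu C A f].
  have [mA|nA] := pselect (measurable A).
    by have [f [vf _]] := exists_version nu sC mA; exists f; case: (vf).
  exists (fun=> 0); split => // [|y]; first exact: bounded_meas_cst.
  by rewrite lexx ler01.
have bv A : bounded_meas C (v A) by have [] := hv A.
have bv' A : bm (v A) by exact: bounded_meas_sub (bv A).
have v01 A y : 0 <= v A y <= 1 by have [_ ->] := hv A.
have mAB A B : A \in P -> B \in Q -> measurable (A `&` B).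
  by move=> AP BQ; apply: measurableI; [exact: mP|exact: mQ].
have vAB A B : A \in P -> B \in Q -> is_version nu C (A `&` B) (v (A `&` B)).
  by move=> AP BQ; have [_ _] := hv (A `&` B); apply; exact: mAB.
have vB B : B \in Q -> is_version nu C B (v B).
  by move=> BQ; have [_ _] := hv B; apply; exact: mQ.
pose rho A B y := ratio (v (A `&` B) y) (v B y).
have rho01 A B y : 0 <= rho A B y <= 1 by exact: ratio01.
have brho A B : bounded_meas C (rho A B) by exact: bounded_meas_ratio.
have brho' A B : bm (rho A B) by exact: bounded_meas_sub (brho A B).
(* The conditional probabilities of the pieces of [B] add up to that of [B]. *)
have sumae B : B \in Q -> ae_eq nu setT (fun y => \sum_(A <- P) v (A `&` B) y) (v B).
  move=> BQ; have bs : bounded_meas C (fun y => \sum_(A <- P) v (A `&` B) y).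
    by apply: bounded_meas_sum => A _.
  have bs' := bounded_meas_sub Cm bs.
  apply: expect_sqr_eq0 => //.
  pose h y := \sum_(A <- P) v (A `&` B) y - v B y.
  have bh : bounded_meas C h by exact: bounded_measB.
  have bh' := bounded_meas_sub Cm bh.
  have -> : (fun y => (\sum_(A <- P) v (A `&` B) y - v B y) *
       (\sum_(A <- P) v (A `&` B) y - v B y)) =
      fun y => \sum_(A <- P) v (A `&` B) y * h y - v B y * h y.
    by apply/funext => y; rewrite -/(h y) -mulr_suml -mulrBl.
  have bvh A : bm (fun y => v A y * h y) by exact: bounded_measM.
  have bs2 : bm (fun y => \sum_(A <- P) v (A `&` B) y * h y).
    by apply: bounded_meas_sum.
  rewrite expectB// expect_sum//.
  rewrite (version_pullout sC (mQ _ BQ) (vB B BQ) bh).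
  have -> : \sum_(A <- P) E (fun y => v (A `&` B) y * h y) =
      \sum_(A <- P) E (fun y => \1_(A `&` B) y * h y).
    rewrite big_seq [RHS]big_seq; apply: eq_bigr => A AP.
    exact: (version_pullout sC (mAB _ _ AP BQ) (vAB _ _ AP BQ) bh).
  rewrite -expect_sum; last first.
    move=> A AP; apply: bounded_measM => //; apply: bounded_meas_indic.
    exact: mAB.
  apply/eqP; rewrite subr_eq0; apply/eqP; congr Rintegral; apply/funext => y.
  have [A0 _ [_ _ sumE]] := partition_cell R y pP.
  rewrite -[RHS](sumE (fun=> \1_B y * h y)); apply: eq_bigr => A _.
  by rewrite indicI mulrA.
have le_of_sum A B y : A \in P -> \sum_(A <- P) v (A `&` B) y = v B y ->
    v (A `&` B) y <= v B y.
  move=> AP <-; rewrite (big_fsetD1 A)//= lerDl; apply: sumr_ge0 => A' _.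
  by have /andP[] := v01 (A' `&` B) y.
have rhole A B : A \in P -> B \in Q ->
    ae_eq nu setT (fun y => v B y * rho A B y) (v (A `&` B)).
  move=> AP BQ; apply: filterS (sumae B BQ) => y /= /(_ I) hy _.
  by apply: mul_ratio; [have /andP[] := v01 (A `&` B) y|exact: le_of_sum].
(* The conditional probability of [A] given the join. *)
pose phi A y := \sum_(B <- Q) \1_B y * rho A B y.
have bphi A : bounded_meas D (phi A).
  apply: bounded_meas_sum => B BQ; apply: bounded_measM.
    by apply: bounded_meas_indic; exact: QD.
  exact: bounded_meas_sub (brho A B).
have vphi A : A \in P -> is_version nu D A (phi A).
  move=> AP; split => // [y|S DS].
    by have [B0 _ [_ _ sumE]] := partition_cell R y pQ; rewrite /phi sumE.
  have [DD CDD SE] := sigma_joinP sC pQ DS.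
  have indS y : \1_S y = \sum_(B <- Q) \1_B y * \1_(DD B) y :> R.
    have [B0 B0Q [B0y uB sumE]] := partition_cell R y pQ.
    rewrite (sumE (fun B => \1_(DD B) y)) !indicE; congr (nat_of_bool _)%:R.
    apply/idP/idP => /set_mem.
      rewrite SE => -[B /= BQ [By DBy]]; apply/mem_set.
      by rewrite -(uB B BQ By).
    by move=> DB; apply/mem_set; rewrite SE; exists B0.
  have bI B : B \in Q -> bm \1_B by move=> BQ; apply: bounded_meas_indic; exact: mQ.
  have bDD B : bounded_meas C (\1_(DD B) : Y -> R) by exact: bounded_meas_indic.
  have bDD' B : bm \1_(DD B) by exact: bounded_meas_sub (bDD B).
  have bA : bm \1_A by apply: bounded_meas_indic; exact: mP.
  have b1 B : B \in Q -> bm (fun y => \1_B y * (rho A B y * \1_(DD B) y)).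
    by move=> BQ; apply: bounded_measM; [exact: bI|exact: bounded_measM].
  have b2 B : B \in Q -> bm (fun y => \1_(A `&` B) y * \1_(DD B) y).
    move=> BQ; apply: bounded_measM => //; apply: bounded_meas_indic; exact: mAB.
  have -> : (fun y => phi A y * \1_S y) =
      fun y => \sum_(B <- Q) \1_B y * (rho A B y * \1_(DD B) y).
    apply/funext => y; rewrite indS /phi.
    have [B0 B0Q [B0y uB sumE]] := partition_cell R y pQ.
    by rewrite (sumE (fun B => rho A B y)) (sumE (fun B => \1_(DD B) y))
      (sumE (fun B => rho A B y * \1_(DD B) y)).
  have -> : (fun y => \1_A y * \1_S y) =
      fun y => \sum_(B <- Q) \1_(A `&` B) y * \1_(DD B) y :> R.
    apply/funext => y; rewrite indS mulr_sumr; apply: eq_bigr => B _.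
    by rewrite indicI mulrA.
  rewrite expect_sum// expect_sum// big_seq [RHS]big_seq; apply: eq_bigr => B BQ.
  have brD : bounded_meas C (fun y => rho A B y * \1_(DD B) y) by exact: bounded_measM.
  rewrite -(version_pullout sC (mQ _ BQ) (vB _ BQ) brD).
  rewrite -(version_pullout sC (mAB _ _ AP BQ) (vAB _ _ AP BQ) (bDD B)).
  apply: expect_ae.
  - by apply: bounded_measM => //; exact: bounded_measM.
  - exact: bounded_measM.
  - by apply: filterS (rhole A B AP BQ) => y /= /(_ I) h _; rewrite mulrA h.
have beta A B : bounded_meas C (fun y => shannon (rho A B y)) by exact: bounded_meas_shannon.
have beta' A B : bm (fun y => shannon (rho A B y)) by exact: bounded_meas_sub (beta A B).
have cellA A : A \in P ->
    cell_entropy nu D A = \sum_(B <- Q) E (fun y => v B y * shannon (rho A B y)).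
  move=> AP; rewrite (cell_entropyE sD (mP _ AP) (vphi A AP)).
  have -> : (fun y => shannon (phi A y)) =
      fun y => \sum_(B <- Q) \1_B y * shannon (rho A B y).
    apply/funext => y; have [B0 _ [_ _ sumE]] := partition_cell R y pQ.
    by rewrite /phi (sumE (fun B => rho A B y)) (sumE (fun B => shannon (rho A B y))).
  rewrite expect_sum; last first.
    by move=> B BQ; apply: bounded_measM => //; apply: bounded_meas_indic; exact: mQ.
  rewrite big_seq [RHS]big_seq; apply: eq_bigr => B BQ.
  by rewrite (version_pullout sC (mQ _ BQ) (vB _ BQ) (beta A B)).
have bev A : bm (fun y => shannon (v A y)) by exact: bounded_meas_shannon.
have sumB B : B \in Q ->
    \sum_(A <- P) E (fun y => v B y * shannon (rho A B y)) =
    \sum_(A <- P) cell_entropy nu C (A `&` B) - cell_entropy nu C B.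
  move=> BQ; rewrite (cell_entropyE sC (mQ _ BQ) (vB _ BQ)).
  have -> : \sum_(A <- P) cell_entropy nu C (A `&` B) =
      \sum_(A <- P) E (fun y => shannon (v (A `&` B) y)).
    rewrite big_seq [RHS]big_seq; apply: eq_bigr => A AP.
    exact: (cell_entropyE sC (mAB _ _ AP BQ) (vAB _ _ AP BQ)).
  have bs1 : bm (fun y => \sum_(A <- P) shannon (v (A `&` B) y)).
    by apply: bounded_meas_sum.
  have bve A : bm (fun y => v B y * shannon (rho A B y)) by exact: bounded_measM.
  rewrite -expect_sum// -expect_sum// -expectB//; apply: expect_ae.
  - exact: bounded_meas_sum.
  - exact: bounded_measB.
  apply: filterS (sumae B BQ) => y /= /(_ I) hy _.
  rewrite {2}/shannon opprK -hy mulr_suml hy -big_split/=.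
  rewrite big_seq [RHS]big_seq; apply: eq_bigr => A AP.
  by apply: mul_shannon_ratio; [have /andP[] := v01 (A `&` B) y|exact: le_of_sum].
rewrite !cond_entropyE sum_part_join//; last exact: cell_entropy_set0.
rewrite exchange_big/= [X in _ = _ + X]big_seq.
rewrite (eq_bigr _ cellA) -big_seq [X in _ = _ + X]exchange_big/=.
rewrite big_seq [X in _ = X + _]big_seq [X in _ = _ + X]big_seq.
rewrite [X in _ = _ + X](eq_bigr _ sumB) -big_split/=.
by apply: eq_bigr => B BQ; rewrite addrC subrK.
Qed.

End ChainRule.

(** * Joins of partitions along finite subsets of the group *)

Section PartitionAlgebra.
Context {d : measure_display} {Y : measurableType d}.
Implicit Types P Q S : {fset (set Y)}.

Lemma part_joinA : associative (@part_join d Y).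
Proof.
move=> P Q S; apply/fsetP => X; apply/part_joinP/part_joinP.
  move=> [A [_ [AP /part_joinP[B [C [BQ CS ->]]] ->]]]; exists (A `&` B), C.
  by split => //; [apply/part_joinP; exists A, B|rewrite setIA].
move=> [_ [C [/part_joinP[A [B [AP BQ ->]]] CS ->]]]; exists A, (B `&` C).
by split => //; [apply/part_joinP; exists B, C|rewrite setIA].
Qed.

Lemma part_joinC : commutative (@part_join d Y).
Proof.
move=> P Q; apply/fsetP => X; apply/part_joinP/part_joinP.
  by move=> [A [B [AP BQ ->]]]; exists B, A; rewrite setIC.
by move=> [A [B [AP BQ ->]]]; exists B, A; rewrite setIC.
Qed.

Lemma part_join1 : left_id [fset [set: Y]]%fset (@part_join d Y).
Proof.
move=> P; apply/fsetP => X; apply/part_joinP/idP.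
  by move=> [_ [B [/fset1P -> BQ ->]]]; rewrite setTI.
by move=> XP; exists setT, X; rewrite setTI; split => //; apply/fset1P.
Qed.

HB.instance Definition _ := Monoid.isComLaw.Build {fset (set Y)}
  [fset [set: Y]]%fset (@part_join d Y) part_joinA part_joinC part_join1.

Lemma part_preimP (f : Y -> Y) P X :
  reflect (exists2 A, A \in P & X = f @^-1` A) (X \in part_preim f P).
Proof. exact: imfsetP. Qed.

Lemma part_preim_join (f : Y -> Y) P Q :
  part_preim f (part_join P Q) = part_join (part_preim f P) (part_preim f Q).
Proof.
apply/fsetP => X; apply/part_preimP/part_joinP.
  move=> [_ /part_joinP[A [B [AP BQ ->]]] ->]; exists (f @^-1` A), (f @^-1` B).
  by rewrite preimage_setI; split => //; apply/part_preimP; [exists A|exists B].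
move=> [_ [_ [/part_preimP[A AP ->] /part_preimP[B BQ ->] ->]]].
by exists (A `&` B); rewrite ?preimage_setI//; apply/part_joinP; exists A, B.
Qed.

Lemma part_preim1 (f : Y -> Y) :
  part_preim f [fset [set: Y]]%fset = [fset [set: Y]]%fset.
Proof.
apply/fsetP => X; apply/part_preimP/fset1P => [[_ /fset1P -> ->]|->].
  by rewrite preimage_setT.
by exists setT; rewrite ?preimage_setT//; apply/fset1P.
Qed.

Lemma measurable_partition1 : measurable_partition [fset [set: Y]]%fset.
Proof.
split.
- by move=> A /fset1P ->; exact: measurableT.
- by move=> A B /fset1P -> /fset1P ->; rewrite eqxx.
- apply/seteqP; split => // y _; exists setT => //=; exact/fset1P.
Qed.

Lemma measurable_partition_preim (f : Y -> Y) P : measurable_fun setT f ->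
  measurable_partition P -> measurable_partition (part_preim f P).
Proof.
move=> mf [mP dP cP]; split.
- move=> _ /part_preimP[A AP ->]; rewrite -[_ @^-1` _]setTI.
  by apply: mf => //; exact: mP.
- move=> _ _ /part_preimP[A AP ->] /part_preimP[B BP ->] AB.
  rewrite -preimage_setI (dP A B)// ?preimage_set0//.
  by apply: contraNneq AB => ->.
- apply/seteqP; split => // y _.
  have [A /= AP Ay] : (\bigcup_(A in [set` P]) A) (f y) by rewrite cP.
  by exists (f @^-1` A) => //=; apply/part_preimP; exists A.
Qed.

End PartitionAlgebra.

Section Orbits.
Context {d : measure_display} {Y : measurableType d} {G : groupType}.
Context (act : G -> Y -> Y).
Context (act_measurable : forall g, measurable_fun [set: Y] (act g)).
Implicit Types (P Q : {fset (set Y)}) (F K L : {fset G}).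

Lemma part_orbit0 P : part_orbit act P fset0 = [fset [set: Y]]%fset.
Proof. by rewrite /part_orbit big_seq_fset0. Qed.

Lemma part_orbit1 P g : part_orbit act P [fset g]%fset = part_preim (act g) P.
Proof. by rewrite /part_orbit big_seq_fset1. Qed.

Lemma part_orbitU1 P F g : g \notin F ->
  part_orbit act P (g |` F)%fset = part_join (part_preim (act g) P) (part_orbit act P F).
Proof. by move=> gF; rewrite /part_orbit big_fsetU1. Qed.

Lemma part_orbitD P F K : (F `<=` K)%fset ->
  part_orbit act P K = part_join (part_orbit act P (K `\` F)%fset) (part_orbit act P F).
Proof.
move=> /fsubsetP FK; rewrite part_joinC /part_orbit (big_fsetID _ (mem F)).
congr part_join; congr bigop; congr enum_fset; apply/fsetP => x; rewrite !inE/=.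
  by apply/andP/idP => [[]//|xF]; split => //; exact: FK.
by rewrite andbC.
Qed.

Lemma part_orbit_join P Q F : part_orbit act (part_join P Q) F =
  part_join (part_orbit act P F) (part_orbit act Q F).
Proof.
by rewrite /part_orbit -big_split; apply: eq_bigr => g _; rewrite part_preim_join.
Qed.

Lemma part_orbit_trivial F :
  part_orbit act [fset [set: Y]]%fset F = [fset [set: Y]]%fset.
Proof. by rewrite /part_orbit big1// => g _; rewrite part_preim1. Qed.

Lemma measurable_partition_orbit P F : measurable_partition P ->
  measurable_partition (part_orbit act P F).
Proof.
move=> pP; rewrite /part_orbit; elim/big_ind: _ => [|A B|g _].
- exact: measurable_partition1.
- exact: measurable_partition_join.
- exact: measurable_partition_preim.
Qed.

Lemma part_orbit_sigma_sub P F K : measurable_partition P -> (F `<=` K)%fset ->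
  part_sigma (part_orbit act P F) `<=` part_sigma (part_orbit act P K).
Proof.
move=> pP FK; rewrite (part_orbitD P FK) part_joinC; apply: part_sigma_join_sub.
exact: measurable_partition_orbit.
Qed.

Lemma part_orbit_translate P K c : (forall g h y, act (g * h)%g y = act g (act h y)) ->
  part_orbit act P [fset (k * c)%g | k in K]%fset =
  part_preim (act c) (part_orbit act P K).
Proof.
move=> actM; rewrite /part_orbit big_imfset/=; last by move=> x y _ _; exact: mulIg.
rewrite (big_morph _ (part_preim_join (act c)) (part_preim1 (act c))).
apply: eq_bigr => k _; apply/fsetP => X; apply/part_preimP/part_preimP.
  move=> [A AP ->]; exists (act k @^-1` A); first by apply/part_preimP; exists A.
  by apply/seteqP; split => y /=; rewrite actM.
move=> [_ /part_preimP[A AP ->] ->]; exists A => //.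
by apply/seteqP; split => y /=; rewrite actM.
Qed.

End Orbits.

(** * Shearer inequality *)

Section Shearer.
Context {R : realType} {G I : choiceType}.
Implicit Types (f : {fset G} -> R) (F S T : {fset G}).

(** Let [f] be a monotone function of finite sets whose increments decrease.  If
    every point of [F] belongs to at least [k] of the sets [S_ i], then [k] times
    [f F] is at most the sum of the values of [f] on the traces.  The points of
    [F] are added one by one. *)
Lemma shearer f (s : seq I) (S_ : I -> {fset G}) (k : nat) F :
  f fset0 = 0 ->
  (forall S T, (S `<=` T)%fset -> f S <= f T) ->
  (forall S T x, (S `<=` T)%fset -> x \notin T ->
    f (x |` T)%fset - f T <= f (x |` S)%fset - f S) ->
  (forall x, x \in F -> (k <= count (fun i => x \in S_ i) s)%N) ->
  k%:R * f F <= \sum_(i <- s) f (S_ i `&` F)%fset.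
Proof.
move=> f0 fmono fsub; elim/fset1U_rect: F => [_|x F xF ih cover].
  rewrite f0 mulr0; apply: sumr_ge0 => i _.
  by rewrite -f0; apply: fmono; exact: fsub0set.
have {}ih := ih (fun y yF => cover y (fset1Ur _ yF)).
pose del := f (x |` F)%fset - f F.
have del0 : 0 <= del by rewrite subr_ge0; apply: fmono; exact: fsubsetUr.
have step i : f (S_ i `&` F)%fset + (x \in S_ i)%:R * del <= f (S_ i `&` (x |` F))%fset.
  have [xS|xS] := boolP (x \in S_ i).
    have -> : (S_ i `&` (x |` F) = x |` (S_ i `&` F))%fset.
      by apply/fsetP => y; rewrite !inE; case: eqP => [->|]//=; rewrite xS.
    rewrite mul1r -lerBrDl; apply: fsub => //; exact: fsubsetIr.
  by rewrite mul0r addr0; apply: fmono; apply: fsetIS; exact: fsubsetUr.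
apply: le_trans (ler_sum _ (fun i _ => step i)).
rewrite big_split/= -mulr_suml -natr_sum.
have -> : f (x |` F)%fset = f F + del by rewrite /del addrC subrK.
rewrite mulrDr lerD// ler_wpM2r// ler_nat.
apply: (leq_trans (cover x (fset1U1 _ _))).
by rewrite -sum1_count big_mkcond/=; apply: leq_sum => i _; case: (_ \in _).
Qed.

End Shearer.

(** * Approximation in a sigma-algebra generated by a directed union *)

Section DirectedUnion.
Context {R : realType} {d : measure_display} {Y : measurableType d}.
Context (nu : probability Y R).
Implicit Types (A B S : set Y) (D : set (set Y)).

Local Notation E f := (Rintegral nu setT f).

Lemma set_dist_triangle A B S : measurable A -> measurable B -> measurable S ->
  set_dist nu A S <= set_dist nu A B + set_dist nu B S.
Proof.
move=> mA mB mS; rewrite /set_dist -expectD; try exact: bounded_meas_set_dist.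
apply: expect_le; first exact: bounded_meas_set_dist.
  by apply: bounded_measD; exact: bounded_meas_set_dist.
by move=> y; exact: ler_distD.
Qed.

Lemma set_distC A B : measurable A -> measurable B ->
  set_dist nu (setT `\` A) (setT `\` B) = set_dist nu A B.
Proof.
move=> mA mB; congr Rintegral; apply/funext => y.
rewrite !indicE !in_setD !in_setT/=.
by case: (y \in A); case: (y \in B); rewrite /= ?subrr ?subr0 ?sub0r ?normrN.
Qed.

Lemma set_distU A B A' B' : measurable A -> measurable B -> measurable A' ->
  measurable B' ->
  set_dist nu (A `|` A') (B `|` B') <= set_dist nu A B + set_dist nu A' B'.
Proof.
move=> mA mB mA' mB'; rewrite /set_dist -expectD; try exact: bounded_meas_set_dist.
apply: expect_le; first by apply: bounded_meas_set_dist; exact: measurableU.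
  by apply: bounded_measD; exact: bounded_meas_set_dist.
move=> y; rewrite !indicE !in_setU.
case: (y \in A); case: (y \in B); case: (y \in A'); case: (y \in B');
  by rewrite /= ?subrr ?subr0 ?sub0r ?normrN ?normr0 ?normr1 ?addr0 ?add0r ?lerDl ?ler01.
Qed.

Lemma set_dist_subset A B : measurable A -> measurable B -> A `<=` B ->
  set_dist nu B A = fine (nu B) - fine (nu A).
Proof.
move=> mA mB AB; rewrite -!expect_indic// -expectB; try exact: bounded_meas_indic.
congr Rintegral; apply/funext => y; rewrite !indicE.
have [yA|yA] := boolP (y \in A); last by rewrite subr0 normr_nat.
by rewrite (_ : y \in B) ?subrr ?normr0//; move/set_mem/AB/mem_set: yA.
Qed.

(** Every set of the sigma-algebra generated by an increasing directed union of
    sigma-algebras is approximated by a set of one of them: the sets with this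
    property form a sigma-algebra. *)
Lemma approximable_directed (G : choiceType) (D_ : {fset G} -> set (set Y))
  (D : set (set Y)) :
  (forall K, is_sub_sigma (D_ K)) ->
  (forall K L, (K `<=` L)%fset -> D_ K `<=` D_ L) ->
  (forall S, D S -> exists K, D_ K S) ->
  forall S r, <<s D >> S -> 0 < r -> exists K, approximable nu (D_ K) S r.
Proof.
move=> sD_ D_mono gen.
pose K : set (set Y) := [set S | measurable S /\
  forall r, 0 < r -> exists K, approximable nu (D_ K) S r].
have K0 : K set0.
  split => // r r0; exists fset0, set0; last by rewrite set_dist_refl ltW.
  by have [[]] := sD_ fset0.
have mD_ L B : D_ L B -> measurable B by exact: (sD_ L).2.
have KU A B : K A -> K B -> K (A `|` B).
  move=> [mA hA] [mB hB]; split=> [|r r0]; first exact: measurableU.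
  have r20 : 0 < r / 2 by rewrite divr_gt0.
  have [L1 [A' DA' dA]] := hA _ r20; have [L2 [B' DB' dB]] := hB _ r20.
  exists (L1 `|` L2)%fset, (A' `|` B').
    have h1 := D_mono _ _ (fsubsetUl L1 L2) _ DA'.
    have h2 := D_mono _ _ (fsubsetUr L1 L2) _ DB'.
    move: h1 h2; rewrite -(measurable_g_measurableTypeE (sD_ _).1).
    exact: measurableU.
  apply: (le_trans (set_distU mA (mD_ _ _ DA') mB (mD_ _ _ DB'))).
  by rewrite [leRHS]splitr lerD.
have sK : sigma_algebra setT K.
  split => //.
  - move=> A [mA hA]; split => [|r r0]; first exact: measurableD.
    have [L [B DB dB]] := hA r r0; exists L, (setT `\` B).
      by have [[_ CC _] _] := sD_ L; exact: CC.
    by rewrite set_distC//; exact: mD_ DB.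
  - move=> A KA; have mA i : measurable (A i) by have [] := KA i.
    have mU : measurable (\bigcup_n A n) by exact: bigcupT_measurable.
    split => // r r0; have r20 : 0 < r / 2 by rewrite divr_gt0.
    pose U n := \big[setU/set0]_(i < n) A i.
    have KUn n : K (U n).
      by rewrite /U; elim/big_ind: _.
    have mUn n : measurable (U n) by have [] := KUn n.
    have bigU : \bigcup_n U n = \bigcup_n A n.
      apply/seteqP; split => y [n _]; rewrite /U.
        by rewrite -bigcup_mkord => -[i _ Ay]; exists i.
      by move=> Ay; exists n.+1 => //; rewrite -bigcup_mkord; exists n => /=.
    have cvU : (fun n => fine (nu (U n))) @ \oo --> fine (nu (\bigcup_n A n)).
      apply: fine_cvg; rewrite fineK ?fin_num_measure// -bigU.
      apply: nondecreasing_cvg_mu => //; first by rewrite bigU.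
      move=> n m nm; apply/subsetPset; rewrite /U -!bigcup_mkord => y [i /= ltin Ay].
      by exists i => //=; exact: leq_trans nm.
    (* A finite union exhausts the countable one up to r / 2. *)
    have [n hn] : exists n, set_dist nu (\bigcup_n A n) (U n) <= r / 2.
      have /cvgrPdist_le /(_ _ r20) [n _ hn] := cvU.
      exists n; rewrite set_dist_subset//; last by rewrite -bigU; exact: bigcup_sup.
      by apply: le_trans (ler_norm _) (hn n (leqnn n)).
    have [L [B DB dB]] := (KUn n).2 _ r20; exists L, B => //.
    apply: (le_trans (set_dist_triangle mU (mUn n) (mD_ _ _ DB))).
    by rewrite [leRHS]splitr lerD.
have DK : <<s D >> `<=` K.
  apply: smallest_sub => // S /gen[L DS]; split; first exact: mD_ DS.
  by move=> r r0; exists L, S => //; rewrite set_dist_refl ltW.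
by move=> S r /DK[_]; apply.
Qed.

End DirectedUnion.

(** * Invariance and monotonicity of the entropy of orbits *)

Section ActionEntropy.
Context {R : realType} {d : measure_display} {Y : measurableType d}.
Context {nu : probability Y R} {G : groupType} {act : G -> Y -> Y}.
Context (mp : mp_action nu act).
Context {C : set (set Y)} (sC : is_sub_sigma C) (iC : invariant_sigma nu act C).
Implicit Types (P Q : {fset (set Y)}) (F K L : {fset G}) (D : set (set Y)).

Local Notation mact := (mp_action_measurable mp).
Local Notation orb := (part_orbit act).
Local Notation orbC Q F := (sigma_join (part_sigma (orb Q F)) C).

Lemma actVK g y : act g (act g^-1%g y) = y.
Proof. by rewrite -(mp_actionM mp) mulgV (mp_action1 mp). Qed.

Lemma preimage_act_inj g : injective (fun A : set Y => act g @^-1` A).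
Proof.
move=> A B AB; apply/seteqP; split => y Ay.
  have : (act g @^-1` A) (act g^-1%g y) by rewrite /= actVK.
  by rewrite AB /= actVK.
have : (act g @^-1` B) (act g^-1%g y) by rewrite /= actVK.
by rewrite -AB /= actVK.
Qed.

(** Both inequalities are [cell_entropy_preimage], for [g] and for its inverse. *)
Lemma cell_entropy_act g A : measurable A ->
  cell_entropy nu C (act g @^-1` A) = cell_entropy nu C A.
Proof.
have le h B : measurable B -> cell_entropy nu C (act h @^-1` B) <= cell_entropy nu C B.
  move=> mB; apply: cell_entropy_preimage => //; [exact: mact|exact: mp_action_preserving|].
  exact: (iC h).1.
move=> mA; apply/eqP; rewrite eq_le; apply/andP; split; first exact: le.
have mgA : measurable (act g @^-1` A) by rewrite -[_ @^-1` _]setTI; exact: mact.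
have gA : act g^-1%g @^-1` (act g @^-1` A) = A.
  by apply/seteqP; split => y /=; rewrite actVK.
by have := le g^-1%g _ mgA; rewrite gA.
Qed.

Lemma cond_entropy_act g P : measurable_partition P ->
  cond_entropy nu (part_preim (act g) P) C = cond_entropy nu P C.
Proof.
move=> [mP _ _]; rewrite !cond_entropyE.
transitivity (\sum_(A <- P) cell_entropy nu C (act g @^-1` A)).
  by rewrite big_imfset//= => A B _ _; exact: preimage_act_inj.
by apply: eq_big_seq => A /mP; exact: cell_entropy_act.
Qed.

Lemma is_sub_sigma_orbC Q F : measurable_partition Q -> is_sub_sigma (orbC Q F).
Proof.
move=> pQ; apply: is_sub_sigma_join; last by case: sC.
by apply: part_sigma_measurable; exact: measurable_partition_orbit mact _ _ pQ.
Qed.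

Lemma orbC_sub Q F K : measurable_partition Q -> (F `<=` K)%fset ->
  orbC Q F `<=` orbC Q K.
Proof. by move=> pQ FK; apply: sigma_join_sub; exact: part_orbit_sigma_sub mact _ _ _ pQ FK. Qed.

(** By the chain rule the entropy given the join is a difference of entropies
    given [C], which are invariant; the join itself need not be compared with its
    preimage. *)
Lemma cond_entropy_translate P Q K L c : measurable_partition P ->
  measurable_partition Q ->
  cond_entropy nu (orb P [fset (k * c)%g | k in K]%fset)
    (orbC Q [fset (l * c)%g | l in L]%fset) =
  cond_entropy nu (orb P K) (orbC Q L).
Proof.
move=> pP pQ; have pPK := measurable_partition_orbit mact K pP.
have pQL := measurable_partition_orbit mact L pQ.
have actM := mp_actionM mp.
rewrite (part_orbit_translate P K c actM) (part_orbit_translate Q L c actM).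
have pPK' := measurable_partition_preim (mact c) pPK.
have pQL' := measurable_partition_preim (mact c) pQL.
apply: (@addrI _ (cond_entropy nu (part_preim (act c) (orb Q L)) C)).
apply: (etrans (esym (chain_rule nu sC pPK' pQL'))); rewrite -part_preim_join.
rewrite (cond_entropy_act c (measurable_partition_join pPK pQL)).
by rewrite (cond_entropy_act c pQL) (chain_rule nu sC pPK pQL).
Qed.

Lemma cond_entropy_orbit0 P D : is_sub_sigma D -> cond_entropy nu (orb P fset0) D = 0.
Proof.
by move=> sD; rewrite part_orbit0 cond_entropyE big_seq_fset1 cell_entropy_setT.
Qed.

Lemma cond_entropy_orbit_mono P D F K : is_sub_sigma D -> measurable_partition P ->
  (F `<=` K)%fset -> cond_entropy nu (orb P F) D <= cond_entropy nu (orb P K) D.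
Proof.
move=> sD pP FK; rewrite (part_orbitD _ _ FK).
have pF L := measurable_partition_orbit mact L pP.
rewrite chain_rule// lerDl; apply: cond_entropy_ge0.
  by apply: is_sub_sigma_join; [exact: part_sigma_measurable|case: sD].
by case: (pF (K `\` F)%fset).
Qed.

(** Strong subadditivity: the increment is the entropy of one more translate given
    the previous ones. *)
Lemma cond_entropy_orbit_marginal P D F K x : is_sub_sigma D ->
  measurable_partition P -> (F `<=` K)%fset -> x \notin K ->
  cond_entropy nu (orb P (x |` K)%fset) D - cond_entropy nu (orb P K) D <=
  cond_entropy nu (orb P (x |` F)%fset) D - cond_entropy nu (orb P F) D.
Proof.
move=> sD pP FK xK; have xF : x \notin F by apply: contra xK => /(fsubsetP FK).
have pF L := measurable_partition_orbit mact L pP.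
have px := measurable_partition_preim (mact x) pP.
rewrite !part_orbitU1// !chain_rule//.
rewrite [leLHS]addrAC subrr add0r [leRHS]addrAC subrr add0r.
apply: cond_entropy_sub.
- by apply: is_sub_sigma_join; [exact: part_sigma_measurable|case: sD].
- by apply: is_sub_sigma_join; [exact: part_sigma_measurable|case: sD].
- by case: px.
- by apply: sigma_join_sub; exact: part_orbit_sigma_sub mact _ _ _ pP FK.
Qed.

Lemma cond_entropy_orbit_directed P Q K e : measurable_partition P ->
  measurable_partition Q -> 0 < e ->
  exists L, cond_entropy nu (orb P K) (orbC Q L) <=
    cond_entropy nu (orb P K) (sigma_join (orbit_sigma act Q) C) + e.
Proof.
move=> pP pQ e0; have [mQ _ _] := pQ; have [mPK _ _] := measurable_partition_orbit mact K pP.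
have orbm : orbit_sigma act Q `<=` measurable.
  apply: (generated_is_sub_sigma _).2 => _ [g _ /= /part_preimP[A AQ ->]].
  by rewrite -[_ @^-1` _]setTI; apply: mact => //; exact: mQ.
apply: cond_entropy_directed => //.
- by apply: is_sub_sigma_join => //; case: sC.
- by move=> L; exact: is_sub_sigma_orbC.
- by move=> L M; exact: orbC_sub.
- pose gens := (\bigcup_(g in [set: G]) [set` part_preim (act g) Q]) `|` C.
  have sub : sigma_join (orbit_sigma act Q) C `<=` <<s gens >>.
    apply: smallest_sub; first exact: smallest_sigma_algebra.
    rewrite subUset; split; last by move=> A CA; apply: sub_sigma_algebra; right.
    by apply: sub_sigma_algebra2; exact: subsetUl.
  move=> S r /sub; apply: approximable_directed.
  + by move=> L; exact: is_sub_sigma_orbC.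
  + by move=> L M; exact: orbC_sub.
  + move=> A [[g _ /= Ag]|CA]; last by exists fset0; exact: sub_sigma_joinr.
    exists [fset g]%fset; apply: sub_sigma_joinl; apply: sub_sigma_algebra => /=.
    by rewrite part_orbit1.
Qed.

Lemma orbC_sub_orbit_sigma Q F : measurable_partition Q ->
  orbC Q F `<=` sigma_join (orbit_sigma act Q) C.
Proof.
move=> pQ; apply: sigma_join_sub; apply: smallest_sub; first exact: smallest_sigma_algebra.
have sO : sigma_algebra setT (orbit_sigma act Q) by exact: smallest_sigma_algebra.
rewrite /part_orbit.
apply: (@big_ind _ (fun P : {fset (set Y)} => [set` P] `<=` orbit_sigma act Q)).
- move=> _ /= /fset1P ->.
  by rewrite -(measurable_g_measurableTypeE sO); exact: measurableT.
- move=> P P' hP hP' _ /= /part_joinP[A [B [AP BP ->]]].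
  have := hP _ AP; have := hP' _ BP.
  rewrite -(measurable_g_measurableTypeE sO) => mB mA.
  exact: measurableI.
- by move=> g _ A /= Ag; apply: sub_sigma_algebra; exists g.
Qed.

End ActionEntropy.

(** * Counting translates in a Folner set *)

Section Folner.
Context {R : realType} {G : groupType}.
Implicit Types (F K L : {fset G}).

(** The left translate gF. *)
Definition translate g F : {fset G} := [fset (g * x)%g | x in F]%fset.

(** The symmetric difference of [F] and gF, whose relative size tends to 0 along
    a Folner sequence. *)
Definition folner_boundary g F : {fset G} :=
  ((translate g F `\` F) `|` (F `\` translate g F))%fset.

Lemma sum_mem_le (T : choiceType) (I X : {fset T}) :
  \sum_(c <- I) (c \in X)%:R <= #|` X|%:R :> R.
Proof.
have -> : \sum_(c <- I) (c \in X)%:R = (count (fun c => c \in X) I)%:R :> R.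
  rewrite -sum1_count natr_sum [RHS]big_mkcond/=; apply: eq_bigr => c _.
  by case: (c \in X).
rewrite ler_nat -size_filter; apply: uniq_leq_size; first by apply: filter_uniq; exact: fset_uniq.
by move=> c; rewrite mem_filter => /andP[].
Qed.

(** The elements [c] such that the right translate Kc meets [F]. *)
Definition translates_meeting K F : {fset G} :=
  [fset (k^-1 * x)%g | k in K, x in F]%fset.

(** Every point of [F] lies in at least [#|K|] of the right translates Kc. *)
Lemma translates_cover K F x : x \in F ->
  (#|` K| <= count (fun c => x \in [fset (k * c)%g | k in K]%fset)
     (translates_meeting K F))%N.
Proof.
move=> xF; rewrite -size_filter.
have -> : #|` K| = size [seq (k^-1 * x)%g | k <- K] by rewrite size_map.
apply: uniq_leq_size.
  by rewrite map_inj_uniq ?fset_uniq// => k l /mulIg /invg_inj.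
move=> c /mapP[k kK ->]; rewrite mem_filter; apply/andP; split.
  by apply/imfsetP; exists k => //=; rewrite mulVKg.
by apply/imfset2P; exists k => //; exists x.
Qed.

(** If Kc meets [F] but Lc is not contained in [F], then [c] lies in the boundary
    of [F] with respect to the inverse of an element of [K] or of [L]. *)
Lemma bad_translate K L F c : 1%g \in L -> c \in translates_meeting K F ->
  ~~ ([fset (l * c)%g | l in L] `<=` F)%fset ->
  has (fun g => c \in folner_boundary g F) [seq g^-1%g | g <- K ++ L].
Proof.
move=> L1 /imfset2P[k kK [x xF cE]] nLc.
have [cF|cF] := boolP (c \in F); last first.
  apply/hasP; exists k^-1%g; first by rewrite map_f// mem_cat kK.
  rewrite !inE cF/=; apply/orP; left.
  by apply/imfsetP; exists x.
have /fsubsetPn[y yLc yF] := nLc.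
have /imfsetP[l /= lL yE] := yLc.
apply/hasP; exists l^-1%g; first by rewrite map_f// mem_cat lL orbT.
rewrite !inE cF/= andbT; apply/negP => /imfsetP[z /= zF cz].
by move: yF; rewrite yE cz mulVKg zF.
Qed.

End Folner.

Section MeanEntropy.
Context {R : realType} {d : measure_display} {Y : measurableType d}.
Context {nu : probability Y R} {G : groupType} {act : G -> Y -> Y}.
Context (mp : mp_action nu act).
Context {C : set (set Y)} (sC : is_sub_sigma C) (iC : invariant_sigma nu act C).
Context {alpha beta : {fset (set Y)}}.
Context (pa : measurable_partition alpha) (pb : measurable_partition beta).
Implicit Types (F K L : {fset G}).

Local Notation orb := (part_orbit act).
Local Notation orbC Q F := (sigma_join (part_sigma (orb Q F)) C).

(** Shearer inequality for the translates Kc.  When Lc is contained in [F], the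
    entropy of the translate given the orbit of [beta] over [F] is at most the one
    given the orbit over Lc, which invariance brings back to [K] and [L].  The
    other translates are few, and each contributes at most the entropy
    given [C]. *)
Lemma entropy_count K L F : 1%g \in L ->
  #|` K|%:R * cond_entropy nu (orb alpha F) (orbC beta F) <=
  #|` F|%:R * cond_entropy nu (orb alpha K) (orbC beta L) +
  (\sum_(g <- [seq g^-1%g | g <- K ++ L]) #|` folner_boundary g F|%:R) *
    cond_entropy nu (orb alpha K) C.
Proof.
move=> L1; set v := cond_entropy nu (orb alpha K) _; set M := cond_entropy nu _ C.
set T := [seq _ | _ <- _]; pose I := translates_meeting K F.
pose Kc c := [fset (k * c)%g | k in K]%fset; pose D := orbC beta F.
have sD : is_sub_sigma D by exact: (is_sub_sigma_orbC mp sC).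
pose f S := cond_entropy nu (orb alpha S) D.
have morb S A : A \in orb alpha S -> measurable A.
  by have [+ _ _] := measurable_partition_orbit (mp_action_measurable mp) S pa; apply.
have v0 : 0 <= v.
  by apply: cond_entropy_ge0 => [|A]; [exact: (is_sub_sigma_orbC mp sC)|exact: morb].
have M0 : 0 <= M by apply: cond_entropy_ge0 => [//|A]; exact: morb.
have fmono S S' : (S `<=` S')%fset -> f S <= f S'.
  exact: (cond_entropy_orbit_mono mp sD pa).
(* Shearer inequality over the [c] such that Kc meets [F]. *)
have f0 : f fset0 = 0 by exact: cond_entropy_orbit0.
have h := @shearer R G G f I Kc #|` K| F f0 fmono
  (fun S S' x => cond_entropy_orbit_marginal mp sD pa (F := S) (K := S') (x := x))
  (fun x => @translates_cover G K F x).
apply: (le_trans h) => {h}.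
have cell c : c \in I -> f (Kc c `&` F)%fset <=
    (c \in F)%:R * v + (\sum_(g <- T) (c \in folner_boundary g F)%:R) * M.
  move=> cI; have S0 : 0 <= \sum_(g <- T) (c \in folner_boundary g F)%:R :> R.
    by apply: sumr_ge0.
  apply: (le_trans (fmono _ _ (fsubsetIl _ _))); rewrite /f.
  have [good|bad] := boolP ([fset (l * c)%g | l in L] `<=` F)%fset.
    have cF : c \in F.
      by apply: (fsubsetP good); apply/imfsetP; exists 1%g => //=; rewrite mul1g.
    rewrite cF mul1r -[leLHS]addr0; apply: lerD; last exact: mulr_ge0.
    rewrite /v -(cond_entropy_translate mp sC iC K L c pa pb).
    apply: cond_entropy_sub => //.
    - exact: (is_sub_sigma_orbC mp sC).
    - by move=> A; exact: morb.
    - exact: (orbC_sub mp).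
  rewrite -[leLHS]add0r; apply: lerD; first by rewrite mulr_ge0.
  have -> : M = cond_entropy nu (orb alpha (Kc c)) C.
    rewrite (part_orbit_translate alpha K c (mp_actionM mp)).
    by rewrite (cond_entropy_act mp sC iC)//;
      exact: (measurable_partition_orbit (mp_action_measurable mp)).
  apply: (@le_trans _ _ (1 * cond_entropy nu (orb alpha (Kc c)) C)).
    rewrite mul1r; apply: cond_entropy_sub => //; last exact: sub_sigma_joinr.
    by move=> A; exact: morb.
  apply: ler_wpM2r; first by apply: cond_entropy_ge0 => [//|A]; exact: morb.
  have := bad_translate L1 cI bad; rewrite has_count -sum1_count big_mkcond/=.
  by rewrite -natr_sum ler1n => /leq_trans; apply; apply: leq_sum => g _; case: (_ \in _).
rewrite big_seq; apply: (le_trans (ler_sum _ cell)); rewrite -big_seq.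
rewrite big_split/= -!mulr_suml; apply: lerD.
  by apply: ler_wpM2r => //; exact: sum_mem_le.
apply: ler_wpM2r => //; rewrite exchange_big/=; apply: ler_sum => g _.
exact: sum_mem_le.
Qed.

End MeanEntropy.

(** * Passage to the limit *)

Section Limits.
Context {R : realType}.

(** The common limit is the infimum of [b]. *)
Lemma cvg_squeeze_inf (a b : nat -> R) :
  (forall n, 0 <= b n) -> (forall n, b n <= a n) ->
  (forall m e, 0 < e -> \forall n \near \oo, a n <= b m + e) ->
  exists l : R, a @ \oo --> l /\ b @ \oo --> l.
Proof.
move=> b0 ba hab; pose l := inf (range b).
have hi : has_inf (range b).
  by split; [exists (b 0%N), 0%N|exists 0 => _ [n _ <-]].
have lb n : l <= b n by apply: ge_inf; [case: hi|exists n].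
have key e : 0 < e -> \forall n \near \oo, a n <= l + e.
  move=> e0; have e20 : 0 < e / 2 by rewrite divr_gt0.
  have [_ [m _ <-] bm] := inf_adherent e20 hi.
  apply: filterS (hab m _ e20) => n /le_trans; apply.
  by rewrite [in leRHS](splitr e) addrA lerD2r ltW.
exists l; split; apply/cvgrPdist_le => e e0; apply: filterS (key e e0) => n han.
  rewrite distrC ger0_norm ?subr_ge0 ?lerBlDl//.
  exact: le_trans (lb n) (ba n).
rewrite distrC ger0_norm ?subr_ge0// lerBlDl.
exact: le_trans (ba n) han.
Qed.

Lemma cvg_sum0 (I : Type) (s : seq I) (u : I -> nat -> R) :
  (forall i, u i @ \oo --> (0 : R)) ->
  (fun n => \sum_(i <- s) u i n) @ \oo --> (0 : R).
Proof.
move=> hu; elim: s => [|i s ih].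
  rewrite (_ : (fun _ => _) = fun=> 0); first exact: cvg_cst.
  by apply/funext => n; rewrite big_nil.
rewrite (_ : (fun _ => _) = fun n => u i n + \sum_(j <- s) u j n); last first.
  by apply/funext => n; rewrite big_cons.
by have := cvgD (hu i) ih; rewrite addr0; exact.
Qed.

End Limits.

Section MeanEntropyLimit.
Context {R : realType} {d : measure_display} {Y : measurableType d}.
Context {nu : probability Y R} {G : groupType} {act : G -> Y -> Y}.
Context (mp : mp_action nu act).
Context {C : set (set Y)} (sC : is_sub_sigma C) (iC : invariant_sigma nu act C).
Context {alpha beta : {fset (set Y)}}.
Context (pa : measurable_partition alpha) (pb : measurable_partition beta).
Context {F : nat -> {fset G}} (folF : folner R F).

Local Notation orb := (part_orbit act).
Local Notation orbC Q F := (sigma_join (part_sigma (orb Q F)) C).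
Local Notation Cinf := (sigma_join (orbit_sigma act beta) C).

Lemma folner_card_gt0 n : 0 < #|` F n|%:R :> R.
Proof. by rewrite ltr0n cardfs_gt0; exact: folner_neq0 folF n. Qed.

(** [entropy_count] with K = F m, and [L] so large that conditioning on the orbit
    of [beta] over [L] is almost as good as conditioning on its full orbit. *)
Lemma mean_entropy_eventually m e : 0 < e ->
  \forall n \near \oo,
    cond_entropy nu (orb alpha (F n)) (orbC beta (F n)) / #|` F n|%:R <=
    cond_entropy nu (orb alpha (F m)) Cinf / #|` F m|%:R + e.
Proof.
move=> e0; pose K := F m; pose k : R := #|` K|%:R.
have k0 : 0 < k by exact: folner_card_gt0.
have e2k0 : 0 < e / 2 * k by rewrite mulr_gt0// divr_gt0.
have [L0 hL0] := cond_entropy_orbit_directed mp sC K pa pb e2k0.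
pose L := (1%g |` L0)%fset.
have L1 : 1%g \in L by exact: fset1U1.
pose v := cond_entropy nu (orb alpha K) (orbC beta L).
pose M := cond_entropy nu (orb alpha K) C.
have hv : v <= cond_entropy nu (orb alpha K) Cinf + e / 2 * k.
  apply: le_trans hL0; apply: cond_entropy_sub.
  - exact: (is_sub_sigma_orbC mp sC).
  - exact: (is_sub_sigma_orbC mp sC).
  - by have [] := measurable_partition_orbit (mp_action_measurable mp) K pa.
  - by apply: (orbC_sub mp) => //; exact: fsubsetUr.
pose T := [seq g^-1%g | g <- K ++ L].
pose eps n : R := \sum_(g <- T) #|` folner_boundary g (F n)|%:R / #|` F n|%:R.
have cv : (fun n => M / k * eps n) @ \oo --> (0 : R).
  rewrite -(mulr0 (M / k)); apply: cvgMr; apply: cvg_sum0 => g.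
  exact: (folner_cvg folF g).
have e20 : 0 < e / 2 by rewrite divr_gt0.
have /cvgrPdist_le /(_ _ e20) := cv; apply: filterS => n.
rewrite sub0r normrN => /(le_trans (ler_norm _)) hn.
have f0 := folner_card_gt0 n.
have := @entropy_count _ _ _ _ _ _ mp _ sC iC _ _ pa pb K L (F n) L1.
rewrite -/v -/M -/T -/k => hc.
set h := cond_entropy nu (orb alpha (F n)) _ in hc *.
have eE : \sum_(g <- T) #|` folner_boundary g (F n)|%:R = eps n * #|` F n|%:R.
  rewrite /eps mulr_suml; apply: eq_bigr => g _.
  by rewrite divfK// gt_eqF.
rewrite eE in hc; rewrite ler_pdivrMr//.
rewrite -(ler_pM2l k0); apply: (le_trans hc).
have -> : k * ((cond_entropy nu (orb alpha K) Cinf / k + e) * #|` F n|%:R) =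
    #|` F n|%:R * (cond_entropy nu (orb alpha K) Cinf + e / 2 * k) +
    e / 2 * (k * #|` F n|%:R).
  by field; rewrite gt_eqF.
apply: lerD; first by rewrite ler_wpM2l// ltW.
have -> : eps n * #|` F n|%:R * M = M / k * eps n * (k * #|` F n|%:R).
  by field; rewrite gt_eqF.
by apply: ler_wpM2r => //; rewrite mulr_ge0// ltW.
Qed.

(** Both conditionings give convergent averages, with the same limit. *)
Lemma mean_entropy_cvg : exists l : R,
  (cond_entropy nu (orb alpha (F n)) (orbC beta (F n)) / #|` F n|%:R)
    @[n --> \oo] --> l /\
  (cond_entropy nu (orb alpha (F n)) Cinf / #|` F n|%:R) @[n --> \oo] --> l.
Proof.
have sinf : is_sub_sigma Cinf.
  apply: is_sub_sigma_join; last by case: sC.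
  apply: (generated_is_sub_sigma _).2 => _ [g _ /= /part_preimP[A AQ ->]].
  rewrite -[_ @^-1` _]setTI; apply: (mp_action_measurable mp) => //.
  by case: pb => mb _ _; exact: mb.
have morb n : forall A, A \in orb alpha (F n) -> measurable A.
  by have [] := measurable_partition_orbit (mp_action_measurable mp) (F n) pa.
apply: cvg_squeeze_inf => [n|n|m e]; last exact: mean_entropy_eventually.
- by rewrite divr_ge0 ?ler0n//; apply: cond_entropy_ge0 => //; exact: morb.
- rewrite ler_wpM2r ?invr_ge0 ?ler0n//; apply: cond_entropy_sub => //.
  + exact: (is_sub_sigma_orbC mp sC).
  + exact: morb.
  + exact: orbC_sub_orbit_sigma.
Qed.

End MeanEntropyLimit.

Lemma sigma_join_trivial d (Y : measurableType d) (C : set (set Y)) :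
  is_sub_sigma C -> sigma_join (part_sigma [fset [set: Y]]%fset) C = C.
Proof.
move=> [sC _]; apply/seteqP; split; last exact: sub_sigma_joinr.
apply: smallest_sub => //; rewrite subUset; split => //.
apply: smallest_sub => // _ /= /fset1P ->.
by case: sC => C0 CC _; have := CC _ C0; rewrite setD0.
Qed.

Unset Implicit Arguments.
Set Strict Implicit.

Theorem theorem3p4 (R : realType) (G : groupType) (F : nat -> {fset G})
    (d : measure_display) (Y : measurableType d) (nu : probability Y R)
    (act : G -> Y -> Y) (C : set (set Y)) (alpha beta : {fset (set Y)})
    (Gcountable : countable [set: G]) (Ginfinite : infinite_set [set: G])
    (Ffolner : folner R F) (act_mp : mp_action nu act)
    (Csub : is_sub_sigma C) (Cinv : invariant_sigma nu act C)
    (alpha_part : measurable_partition alpha)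
    (beta_part : measurable_partition beta) :
  (cond_entropy nu (part_orbit act alpha (F n))
     (sigma_join (part_sigma (part_orbit act beta (F n))) C) / #|` F n|%:R)
    @[n --> \oo]
    --> mean_entropy nu F act alpha (sigma_join (orbit_sigma act beta) C)
  /\
  mean_entropy nu F act (part_join alpha beta) C
  = mean_entropy nu F act beta C
    + mean_entropy nu F act alpha (sigma_join (orbit_sigma act beta) C).
Proof.
have [l [la lb]] := mean_entropy_cvg act_mp Csub Cinv alpha_part beta_part Ffolner.
have [l' [lc' _]] := mean_entropy_cvg act_mp Csub Cinv beta_part
  (@measurable_partition1 d Y) Ffolner.
have lc : (cond_entropy nu (part_orbit act beta (F n)) C / #|` F n|%:R)
    @[n --> \oo] --> l'.
  apply: cvg_trans lc'; apply: near_eq_cvg; apply: nearW => n /=.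
  by rewrite part_orbit_trivial (sigma_join_trivial Csub).
have mE : mean_entropy nu F act alpha (sigma_join (orbit_sigma act beta) C) = l.
  exact: cvg_lim lb.
rewrite mE; split => //.
have -> : mean_entropy nu F act beta C = l' by exact: cvg_lim lc.
apply: cvg_lim => //.
rewrite (_ : (fun n => _) = fun n =>
    cond_entropy nu (part_orbit act beta (F n)) C / #|` F n|%:R +
    cond_entropy nu (part_orbit act alpha (F n))
      (sigma_join (part_sigma (part_orbit act beta (F n))) C) / #|` F n|%:R).
  exact: (cvgD lc la).
have mact := mp_action_measurable act_mp.
apply/funext => n; rewrite part_orbit_join -mulrDl; congr (_ / _).
by apply: chain_rule => //; exact: measurable_partition_orbit.
Qed.
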